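(* Let $\Phi$ be an irreducible root system of rank $\ell$ and let $n\geq 0$ be an integer. Then \[ \chi_{quasi}(\mathcal{A}_{\Phi}^{[1,n]},t)=\mathrm{R}_{\Phi}(\overline{\mathrm{S}}^{\,n+1})\,\tilde{\mathrm{L}}_{\Phi}^{\gcd(n+1,\rho)}(t). \] In particular, $\chi_{quasi}(\mathcal{A}_{\Phi}^{[1,n]},t)$ has period $\gcd(n+1,\rho)$.
   Context: Root system data: $\Phi\subset V=\mathbb{R}^{\ell}$ (Euclidean inner product $(\cdot,\cdot)$) is an irreducible crystallographic root system with a fixed positive system $\Phi^{+}$, simple roots $\alpha_1,\dots,\alpha_\ell$, highest root $\tilde\alpha=\sum_{i=1}^{\ell}c_i\alpha_i$ ($c_i\in\mathbb{Z}_{>0}$), and $c_0:=1$. $Z(\Phi)=\{x\in V:(\alpha_i,x)\in\mathbb{Z}\ \forall i\}$ is the coweight lattice, and $f=\#Z(\Phi)/Q(\Phi)$ is the index of connection ($Q(\Phi)$ the coroot lattice). $W$ is the Weyl group. Quasi-polynomials: a function $g:\mathbb{Z}\to\mathbb{C}$ is a quasi-polynomial if there are a positive integer $N$ (a period) and polynomials $g_1,\dots,g_N\in\mathbb{C}[t]$ (constituents) with $g(t)=g_j(t)$ whenever $t\equiv j\bmod N$ (index $N$ for $t\equiv0$); the minimal period is the least period. $\mathrm{L}_\Phi$: the Ehrhart quasi-polynomial of the closed fundamental alcove $\overline{F_\Phi}=\{x\in V:(\alpha_i,x)\ge0\ (1\le i\le\ell),\ (\tilde\alpha,x)\le1\}$,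 i.e. the quasi-polynomial with $\mathrm{L}_\Phi(q)=\#(q\overline{F_\Phi}\cap Z(\Phi))$ for positive integers $q$; its generating function is $\sum_{q\ge0}\mathrm{L}_\Phi(q)x^q=\prod_{i=0}^{\ell}(1-x^{c_i})^{-1}$. $\rho$ denotes the minimal period of $\mathrm{L}_\Phi$. Averaging: for a quasi-polynomial $g$ with minimal period $N$ and constituents $g_1,\dots,g_N$ (indices read mod $N$), and $k\in\mathbb{Z}$, let $g^{\sigma^k}$ be the quasi-polynomial with $g^{\sigma^k}(t)=g_{j-k}(t)$ for $t\equiv j\bmod N$, and $\tilde g^{k}(t):=\frac1N\sum_{i=0}^{N-1}g^{\sigma^{ik}}(t)$. Operators: $(\mathrm{S}^kg)(t)=g(t-k)$; $\overline{\mathrm{S}}$ acts on constituents: $(\overline{\mathrm{S}}^kg)(t)=g_j(t-k)$ for $t\equiv j\bmod N$ ($N$ any period). For a polynomial $P(x)=\sum a_kx^k$, $P(\overline{\mathrm{S}})g=\sum a_k\overline{\mathrm{S}}^kg$. Generalized Eulerian polynomial: $\mathrm{R}_\Phi(t)=\frac1f\sum_{w\in W}t^{\mathrm{asc}(w)}$ where $\mathrm{asc}(w)=\sum_{0\le i\le\ell,\ w(\alpha_i)\in\Phi^+}c_i$ and $\alpha_0:=-\tilde\alpha$. Linial arrangement: $\mathcal{A}_\Phi^{[1,n]}=\{H_{\alpha,k}:\alpha\in\Phi^+,\ 1\le k\le n\}$ with $H_{\alpha,k}=\{x\in V:(\alpha,x)=k\}$ (empty for $n=0$). Its characteristic quasi-polynomial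 $\chi_{quasi}(\mathcal{A}_\Phi^{[1,n]},t)$ is the quasi-polynomial which, for all sufficiently large positive integers $q$, equals $\#\{x\in Z(\Phi)/qZ(\Phi): (\alpha,x)\not\equiv k \bmod q \text{ for all }\alpha\in\Phi^+,\ 1\le k\le n\}$. *)

(* Defs.v *)
From mathcomp Require Import all_boot all_order all_algebra.
From mathcomp Require Import finmap.
From mathcomp Require Import all_classical reals.
From mathcomp Require Import complex.

Set Implicit Arguments.
Unset Strict Implicit.
Unset Printing Implicit Defensive.

Import Order.TTheory GRing.Theory Num.Theory.
Local Open Scope classical_set_scope.
Local Open Scope ring_scope.

Section QuasiPolynomials.
Variable R : realType.
Local Notation C := (R[i]).
Implicit Types (g : int -> C) (N : nat).

(* Residue classes are indexed by arbitrary integers j, so that "indices read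
   mod N" is built in; the class of 0 plays the role of the index N. *)
Definition is_constituent g N (j : int) (p : {poly C}) : Prop :=
  forall t : int, (t = j %[mod N%:Z])%Z -> g t = p.[t%:~R].

Definition is_period g N : Prop :=
  (0 < N)%N /\ forall j : int, exists p, is_constituent g N j p.

Definition quasi_polynomial g : Prop := exists N, is_period g N.

Definition min_period g : nat :=
  xget 0%N [set N | is_period g N /\ forall M, is_period g M -> (N <= M)%N].

(* When N is a period of g, the constituent is unique, because it is
   determined on an infinite set of integers. *)
Definition constituent g N (j : int) : {poly C} := xget 0 (is_constituent g N j).

Definition sigma_shift (k : int) g : int -> C :=
  fun t => (constituent g (min_period g) (t - k)).[t%:~R].

Definition average (k : int) g : int -> C :=
  fun t => (min_period g)%:R^-1 *
           \sum_(0 <= i < min_period g) sigma_shift (i%:Z * k) g t.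

Definition Sbar (k : int) g : int -> C :=
  fun t => (constituent g (min_period g) t).[(t - k)%:~R].

Definition Sbar_poly (P : {poly C}) g : int -> C :=
  fun t => \sum_(k < size P) P`_k * Sbar k%:Z g t.

End QuasiPolynomials.

Section RootSystems.
Variables (R : realType) (l : nat).
Local Notation V := 'rV[R]_l.
Local Notation C := (R[i]).
Implicit Types (Phi : set V) (Delta : 'I_l -> V).

Definition dot (x y : V) : R := (x *m y^T) 0 0.

Definition coroot (a : V) : V := (2 / dot a a) *: a.

Definition reflection (a : V) : V -> V := fun x => x - dot x (coroot a) *: a.

Record root_system Phi : Prop := RootSystem {
  root_finite : finite_set Phi;
  root_span : <<fset_set Phi>>%VS = fullv;
  root_neq0 : ~ Phi 0;
  root_reduced : forall a (r : R), Phi a -> Phi (r *: a) -> r = 1 \/ r = - 1;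
  root_reflection : forall a b, Phi a -> Phi b -> Phi (reflection a b);
  root_crystallographic :
    forall a b, Phi a -> Phi b -> dot b (coroot a) \is a Num.int }.

Definition irreducible_root_system Phi : Prop :=
  [/\ root_system Phi, Phi !=set0 &
      forall A B : set V, A `|` B = Phi ->
        (forall a b, A a -> B b -> dot a b = 0) -> A = set0 \/ B = set0].

Definition nonneg_comb Delta (x : V) : Prop :=
  exists k : 'I_l -> nat, x = \sum_i (k i)%:R *: Delta i.

Definition simple_roots Phi Delta : Prop :=
  [/\ basis_of fullv [tuple Delta i | i < l],
      forall i, Phi (Delta i) &
      forall b, Phi b -> nonneg_comb Delta b \/ nonneg_comb Delta (- b)].

Definition positive_roots Phi Delta : set V :=
  [set b | Phi b /\ nonneg_comb Delta b].

Definition highest_root Phi Delta (h : V) : Prop :=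
  Phi h /\ forall b, Phi b -> nonneg_comb Delta (h - b).

Definition coweight_lattice Delta : set V :=
  [set x | forall i, dot (Delta i) x \is a Num.int].

Definition coroot_lattice Phi : set V :=
  [set x | exists (s : seq V) (z : V -> int), {in s, forall a, Phi a} /\
           x = \sum_(a <- s) (z a)%:~R *: coroot a].

Definition coset (B : set V) (x : V) : set V := [set y | B (y - x)].

(* The number of cosets of the subgroup B that meet A.  Like every use of
   [fset_set] here, it is only meant for finite collections. *)
Definition card_cosets (A B : set V) : nat := #|` fset_set (coset B @` A)|.

Definition index_of_connection Phi Delta : nat :=
  card_cosets (coweight_lattice Delta) (coroot_lattice Phi).

Inductive weyl_group Phi : set (V -> V) :=
| weyl_id : weyl_group Phi id
| weyl_refl a w : Phi a -> weyl_group Phi w ->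
    weyl_group Phi (reflection a \o w).

Definition dilate (r : R) (A : set V) : set V := ( *:%R r) @` A.

(* [c] lists the coefficients of the highest root on the simple roots. *)
Implicit Type c : 'I_l -> nat.

Definition root_of_coefs Delta c : V := \sum_i (c i)%:R *: Delta i.

(* Extended indexing by 0, ..., l, with c_0 = 1 and alpha_0 the opposite of the
   highest root. *)
Definition ext_coef c (i : 'I_l.+1) : nat :=
  if unlift ord0 i is Some j then c j else 1%N.

Definition ext_root Delta c (i : 'I_l.+1) : V :=
  if unlift ord0 i is Some j then Delta j else - root_of_coefs Delta c.

Definition alcove Delta c : set V :=
  [set x | (forall i, 0 <= dot (Delta i) x) /\
           dot (root_of_coefs Delta c) x <= 1].

Definition ehrhart_count Delta c (q : nat) : nat :=
  #|` fset_set (dilate q%:R (alcove Delta c) `&` coweight_lattice Delta)|.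

(* Two quasi-polynomials that agree at all large positive integers are equal,
   so at most one function satisfies the condition below; the same holds for
   [chi_quasi]. *)
Definition ehrhart Delta c : int -> C :=
  xget (fun=> 0) [set g | quasi_polynomial g /\
    forall q : nat, (0 < q)%N -> g q%:Z = (ehrhart_count Delta c q)%:R].

Definition asc Phi Delta c (w : V -> V) : nat :=
  (\sum_(i < l.+1 | w (ext_root Delta c i) \in positive_roots Phi Delta)
     ext_coef c i)%N.

Definition eulerian Phi Delta c : {poly C} :=
  (index_of_connection Phi Delta)%:R^-1 *:
  \sum_(w \in weyl_group Phi) ('X^(asc Phi Delta c w) : {poly C}).

(* The pair (a, k) stands for the hyperplane of equation (a, x) = k; the
   equation itself, not just its zero set, is what gets reduced mod q. *)
Definition linial Phi Delta (n : nat) : set (V * nat) :=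
  [set H | positive_roots Phi Delta H.1 /\ (1 <= H.2 <= n)%N].

Definition congruent_mod (q : nat) (x y : R) : Prop :=
  exists m : int, x - y = m%:~R * q%:R.

(* Points of Z(Phi)/qZ(Phi) off the arrangement; for x in the coweight lattice
   the condition only depends on the class of x. *)
Definition complement_count Delta (A : set (V * nat)) (q : nat) : nat :=
  card_cosets
    [set x | coweight_lattice Delta x /\
             forall H, A H -> ~ congruent_mod q (dot H.1 x) H.2%:R]
    (dilate q%:R (coweight_lattice Delta)).

Definition chi_quasi Delta (A : set (V * nat)) : int -> C :=
  xget (fun=> 0) [set g | quasi_polynomial g /\
    exists q0 : nat, forall q : nat, (q0 < q)%N ->
      g q%:Z = (complement_count Delta A q)%:R].

End RootSystems.

(* Main.v *)
Require Import Defs.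
From mathcomp Require Import all_boot all_order all_algebra.
From mathcomp Require Import finmap.
From mathcomp Require Import all_classical reals.
From mathcomp Require Import complex zify ring lra.

(* Write m = n + 1, L for the Ehrhart quasi-polynomial, S for the shift and
   D = prod_i (1 - x^(c_i)), so that sum_q L(q) x^q = 1 / D.

   A coweight x avoids the Linial arrangement mod q exactly when, up to q times
   the coroot lattice, it lies in one alcove w(q F) with every wall w(alpha_i) > 0
   pushed inwards by m.  The distances a_i of x to these walls are any natural
   numbers with sum_i c_i a_i = q - m asc(w), and x determines w and a because the affine Weyl group
   acts simply transitively on alcoves.  Counting gives chi = R(S^m) L.

   For n = 0 this reads R(S) L = q^l, whence D divides (x - 1)^(l+1) R(x).
   Since D(x) divides D(x^m), the operator (S^m - 1)^(l+1) kills R(S^m) L, which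
   therefore has period m, hence gcd(m, rho).  Averaging commutes with shifts and
   fixes functions of that period, so L may be replaced by its average, on which
   S^m and its action on constituents agree. *)

Set Implicit Arguments.
Unset Strict Implicit.
Unset Printing Implicit Defensive.

Import Order.TTheory GRing.Theory Num.Theory.
Local Open Scope classical_set_scope.
Local Open Scope ring_scope.

(** * Finite differences and quasi-polynomials *)

(** The factor 1/f of the Eulerian polynomial has a geometric origin. The pairs (w, a) describe the
    free coweights modulo q times the coroot lattice, while chi counts them modulo q times the
    coweight lattice. The map between these two quotients has fibres of size f. A coweight may lie
    on walls, and then several closed alcoves contain it. The tie is broken by perturbing x in the
    direction of -rho^vee, with rho^vee the sum of the fundamental coweights. The only walls of the
    chosen alcove that may then contain x are those with w(alpha_i) negative. So already for m = 1
    the positive walls are pushed inwards by 1, and these half-open alcoves partition the coweights;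
    this is the case n = 0. Simple transitivity is not quoted. Existence of the alcove comes from
    minimising an invariant form over a lattice coset, uniqueness from comparing the values of all
    roots at two perturbed points. The Ehrhart counts are known at positive integers only.
    Identities are therefore proved at large q, through power series truncated modulo X^N, and reach
    all integers because a quasi-polynomial is determined by its values at large integers. *)

(** The linear functional on polynomials that takes the value [F k] at ['X^k]. With
    [F k = g (t - k)] it is the value at [t] of the polynomial [P] in the shift operator. *)
Definition coef_apply (K : nzRingType) (F : nat -> K) (P : {poly K}) : K :=
  \sum_(k < size P) P`_k * F k.

Section CoefApply.
Variable K : comNzRingType.
Implicit Types (F G : nat -> K) (P Q : {poly K}).

Lemma coef_apply_widen F P n : (size P <= n)%N ->
  coef_apply F P = \sum_(k < n) P`_k * F k.
Proof.
move=> le; rewrite /coef_apply (big_ord_widen n (fun k => P`_k * F k) le).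
rewrite big_mkcond /=; apply: eq_bigr => k _.
by case: ltnP => // h; rewrite nth_default // mul0r.
Qed.

Lemma eq_coef_apply F G P : (forall k, (k < size P)%N -> F k = G k) ->
  coef_apply F P = coef_apply G P.
Proof. by move=> h; apply: eq_bigr => k _; rewrite h. Qed.

Lemma coef_applyD F P Q :
  coef_apply F (P + Q) = coef_apply F P + coef_apply F Q.
Proof.
rewrite (coef_apply_widen F (size_polyD P Q)).
rewrite (coef_apply_widen F (leq_maxl (size P) (size Q))).
rewrite (coef_apply_widen F (leq_maxr (size P) (size Q))).
by rewrite -big_split /=; apply: eq_bigr => k _; rewrite coefD mulrDl.
Qed.

Lemma coef_applyZ F a P : coef_apply F (a *: P) = a * coef_apply F P.
Proof.
rewrite (coef_apply_widen F (size_scale_leq a P)) mulr_sumr.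
by apply: eq_bigr => k _; rewrite coefZ mulrA.
Qed.

Lemma coef_apply0 F : coef_apply F 0 = 0.
Proof. by rewrite /coef_apply size_poly0 big_ord0. Qed.

Lemma coef_applyXn F n : coef_apply F 'X^n = F n.
Proof.
rewrite /coef_apply size_polyXn big_ord_recr /= coefXn eqxx mul1r.
by rewrite big1 ?add0r // => i _; rewrite coefXn ltn_eqF // mul0r.
Qed.

Lemma coef_apply_ind F (f : {poly K} -> K) P :
    (forall a Q, f (a *: Q) = a * f Q) -> {morph f : Q T / Q + T} -> f 0 = 0 ->
    (forall n, f 'X^n = F n) -> f P = coef_apply F P.
Proof.
move=> fZ fD f0 fX; rewrite -[in LHS](coefK P) poly_def (big_morph f fD f0).
by apply: eq_bigr => i _; rewrite fZ fX.
Qed.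

Lemma coef_apply_comp_Xn F P m : 
  coef_apply F (P \Po 'X^m) = coef_apply (fun k => F (k * m)%N) P.
Proof.
apply: (coef_apply_ind (f := fun Q => coef_apply F (Q \Po 'X^m))).
- by move=> a Q; rewrite comp_polyZ coef_applyZ.
- by move=> Q T; rewrite /= comp_polyD coef_applyD.
- by rewrite comp_poly0 coef_apply0.
- by move=> n; rewrite comp_Xn_poly -exprM coef_applyXn mulnC.
Qed.

Lemma coef_apply_mulXn F P n :
  coef_apply F ('X^n * P) = coef_apply (fun k => F (n + k)%N) P.
Proof.
apply: (coef_apply_ind (f := fun Q => coef_apply F ('X^n * Q))).
- by move=> a Q; rewrite -scalerAr coef_applyZ.
- by move=> Q T; rewrite /= mulrDr coef_applyD.
- by rewrite mulr0 coef_apply0.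
- by move=> k; rewrite -exprD coef_applyXn.
Qed.

(** For shifts this says that a product of polynomials acts as the composite operator. *)
Lemma coef_apply_mul F P Q :
  coef_apply F (P * Q) =
  coef_apply (fun k => coef_apply (fun j => F (k + j)%N) Q) P.
Proof.
apply: (coef_apply_ind (f := fun P => coef_apply F (P * Q))).
- by move=> a T; rewrite -scalerAl coef_applyZ.
- by move=> S T; rewrite /= mulrDl coef_applyD.
- by rewrite mul0r coef_apply0.
- by move=> k; rewrite coef_apply_mulXn.
Qed.

Lemma coef_apply_const0 P : coef_apply (fun=> 0) P = 0.
Proof. by rewrite /coef_apply big1 // => i _; rewrite mulr0. Qed.

Lemma coef_apply_scale F a P :
  coef_apply (fun k => a * F k) P = a * coef_apply F P.
Proof. by rewrite mulr_sumr; apply: eq_bigr => k _; rewrite mulrCA. Qed.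

Lemma coef_mul_apply P Q n : (size P <= n.+1)%N ->
  (P * Q)`_n = coef_apply (fun k => Q`_(n - k)) P.
Proof. by move=> le; rewrite coefM (coef_apply_widen _ le). Qed.

End CoefApply.

Section FiniteDifferences.
Variable K : numFieldType.
Implicit Types (p P : {poly K}).

Lemma poly_eq_nat p P i0 :
  (forall i, (i0 <= i)%N -> p.[i%:R] = P.[i%:R]) -> p = P.
Proof.
move=> h; apply/eqP; rewrite -subr_eq0; apply/negPn/negP => nz.
have := max_poly_roots nz (rs := [seq (i0 + i)%:R | i <- iota 0 (size (p - P))]).
rewrite size_map size_iota ltnn => H; suff: false by []; apply: H.
  apply/allP => x /mapP [i _ ->].
  by rewrite rootE hornerD hornerN h ?leq_addr // subrr.
rewrite map_inj_uniq ?iota_uniq // => i j /eqP.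
by rewrite eqr_nat eqn_add2l => /eqP.
Qed.

Lemma poly_eq_arith p P (a : K) (N i0 : nat) : (0 < N)%N ->
  (forall i, (i0 <= i)%N -> p.[a + N%:R * i%:R] = P.[a + N%:R * i%:R]) -> p = P.
Proof.
move=> N0 h; have N1 : N%:R != 0 :> K by rewrite pnatr_eq0 -lt0n.
(* Composition with the affine map [l], whose inverse is [l'], turns the progression into the
   natural numbers. *)
pose l : {poly K} := N%:R *: 'X + a%:P.
pose l' : {poly K} := N%:R^-1 *: ('X - a%:P).
have ll' : l \Po l' = 'X.
  rewrite /l comp_polyD comp_polyZ comp_polyX comp_polyC /l' scalerA divff //.
  by rewrite scale1r subrK.
suff e : p \Po l = P \Po l.
  by rewrite -[p]comp_polyXr -[P]comp_polyXr -ll' !comp_polyA e.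
apply: (@poly_eq_nat _ _ i0) => i le.
by rewrite !horner_comp /l !hornerE addrC; apply: h.
Qed.

Lemma antidifference p :
  exists P, forall x, P.[x + 1] - P.[x] = p.[x].
Proof.
have [n le] : exists n, (size p <= n)%N by exists (size p).
elim: n p le => [|n IH] p le.
  exists 0 => x; rewrite !horner0 subrr.
  by move: le; rewrite leqn0 size_poly_eq0 => /eqP ->; rewrite horner0.
have n0 : n.+1%:R != 0 :> K by rewrite pnatr_eq0.
(* The difference [T] of [Q] has the same coefficient of degree [n] as [p], so [p - T] falls under
   the induction hypothesis. *)
pose Q : {poly K} := (p`_n / n.+1%:R) *: 'X^(n.+1).
pose T : {poly K} := (Q \Po ('X + 1)) - Q.
have coT j : T`_j = p`_n / n.+1%:R * ((if (j < n.+2)%N then 'C(n.+1, j)%:R else 0) - (j == n.+1)%:R).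
  rewrite coefB /Q comp_polyZ !coefZ comp_Xn_poly coefXn -mulrBr exprD1n.
  have -> : \sum_(i < n.+2) 'X ^+ i *+ 'C(n.+1, i) =
            \poly_(i < n.+2) 'C(n.+1, i)%:R :> {poly K}.
    by rewrite poly_def; apply: eq_bigr => i _; rewrite scaler_nat.
  by rewrite coef_poly.
have sT : (size (p - T)%R <= n)%N.
  apply/leq_sizeP => j; rewrite leq_eqVlt => /orP [/eqP <-|lt].
    by rewrite coefB coT ltnS leqnSn binSn ltn_eqF // subr0 divfK // subrr.
  rewrite coefB [p`_j]nth_default ?(leq_trans le) // coT.
  have [->|ne] := eqVneq j n.+1; first by rewrite ltnSn binn !subrr mulr0 subrr.
  by rewrite ltnNge ltn_neqAle eq_sym ne lt !subrr mulr0 subrr.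
have [P hP] := IH _ sT; exists (P + Q) => x.
have := hP x; rewrite !hornerD hornerN hornerD hornerN horner_comp hornerD hornerX hornerC => e.
have -> : P.[x + 1] + Q.[x + 1] - (P.[x] + Q.[x]) =
   P.[x + 1] - P.[x] + (Q.[x + 1] - Q.[x]) by ring.
by rewrite e subrK.
Qed.

(* The sequence [u] is annihilated by [('X - 1) ^+ d] acting by the backward
   shift; only indices at which no subtraction is truncated are constrained. *)
Lemma diff_eq0_poly d (u : nat -> K) :
    (forall q, (d <= q)%N ->
       coef_apply (fun k => u (q - k)%N) (('X - 1) ^+ d) = 0) ->
  exists p, forall i, u i = p.[i%:R].
Proof.
elim: d u => [|d IH] u h.
  exists 0 => i; rewrite horner0.
  have := h i isT; rewrite expr0 -(expr0 'X).
  by rewrite coef_applyXn subn0.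
have [q le|p hp] := IH (fun i => u i.+1 - u i).
  have := h q.+1 le; rewrite exprSr coef_apply_mul.
  rewrite (eq_coef_apply (G := fun k => -1 * (u (q - k).+1 - u (q - k)%N))).
    by rewrite coef_apply_scale => /eqP; rewrite mulN1r oppr_eq0 => /eqP.
  move=> k; rewrite size_exp_XsubC ltnS => lek.
  rewrite -scaleN1r coef_applyD coef_applyZ.
  rewrite -['X]expr1 coef_applyXn -(expr0 'X) coef_applyXn addn0 addn1 subSS.
  by rewrite subSn ?(leq_trans lek) //; ring.
have [P hP] := antidifference p.
exists (P + (u 0%N - P.[0])%:P); elim=> [|i IHi].
  by rewrite hornerD hornerC addrC subrK.
have -> : u i.+1 = u i + p.[i%:R] by rewrite -hp addrC subrK.
by rewrite IHi -hP !hornerD !hornerC -natr1; ring.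
Qed.

(** Each backward difference lowers the degree: substituting ['X - 1], which is monic, keeps the
    leading coefficient. *)
Lemma diff_poly_size d p : (size p <= d)%N ->
  forall x, coef_apply (fun k => p.[x - k%:R]) (('X - 1) ^+ d) = 0.
Proof.
elim: d p => [|d IH] p le x.
  move: le; rewrite leqn0 size_poly_eq0 => /eqP ->.
  rewrite -[RHS](coef_apply_const0 (('X - 1) ^+ 0)).
  by apply: eq_coef_apply => k _; rewrite horner0.
rewrite exprSr coef_apply_mul; pose T := (p \Po ('X - 1)) - p.
rewrite -[RHS](IH T _ x); last first.
  apply/leq_sizeP => j; rewrite leq_eqVlt => /orP [/eqP <-|lt]; last first.
    rewrite coefB !nth_default ?subrr ?(leq_trans le) //.
    by rewrite size_comp_poly2 ?size_XsubC // (leq_trans le).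
  have [lt|] := ltnP (size p) d.+1.
    rewrite coefB !nth_default ?subrr //.
    by rewrite size_comp_poly2 ?size_XsubC.
  move=> ge; have e : d = (size p).-1 by apply/eqP; rewrite eqn_leq; lia.
  have := lead_coef_comp p (q := 'X - 1).
  rewrite size_XsubC => /(_ isT); rewrite lead_coefXsubC expr1n mulr1.
  rewrite !lead_coefE size_comp_poly2 ?size_XsubC // -e => el.
  by rewrite coefB el subrr.
apply: eq_coef_apply => k _; rewrite /T hornerD hornerN horner_comp !hornerE.
rewrite -scaleN1r coef_applyD coef_applyZ.
rewrite -['X]expr1 coef_applyXn -(expr0 'X) coef_applyXn addn0 addn1.
by rewrite mulN1r -natr1 opprD addrA.
Qed.
End FiniteDifferences.

Lemma eqz_mod_exP (d t j : int) :
  (t = j %[mod d])%Z <-> exists z, t = j + z * d.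
Proof.
split=> [/eqP|[z ->]]; last by rewrite addrC modzMDl.
by rewrite eqz_mod_dvd => /dvdzP [z e]; exists z; rewrite -e addrC subrK.
Qed.

(** * Periods and constituents of quasi-polynomials *)

Section Quasi.
Variable R : realType.
Local Notation C := (R[i]).
Implicit Types (g : int -> C) (N : nat) (p : {poly C}).

(** The progression [j + N * N' * i] stays in the class of [j] for both periods. Allowing two
    periods makes the constituent independent of the period from which it is read. *)
Lemma constituent_uniq g N N' j p p' : (0 < N)%N -> (0 < N')%N ->
  is_constituent g N j p -> is_constituent g N' j p' -> p = p'.
Proof.
move=> N0 N0' h h'.
apply: (@poly_eq_arith _ p p' j%:~R (N * N') 0); first by rewrite muln_gt0 N0.
move=> i _; have -> : j%:~R + (N * N')%:R * i%:R =
    (j + (N * N' * i)%N%:Z)%:~R :> C by rewrite intrD -!natrM.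
rewrite -h -?h' //; apply/eqz_mod_exP.
- by exists (N * i)%N%:Z; rewrite -PoszM; congr (_ + Posz _); ring.
- by exists (N' * i)%N%:Z; rewrite -PoszM; congr (_ + Posz _); ring.
Qed.

Lemma constituentP g N : is_period g N ->
  forall j, is_constituent g N j (constituent g N j).
Proof. by case=> _ h j; apply: (xgetPex 0 (h j)). Qed.
Arguments constituentP {g N} _ j _ _.

Lemma is_constituent_mod g N j j' p : (j = j' %[mod N%:Z])%Z ->
  is_constituent g N j p -> is_constituent g N j' p.
Proof. by move=> e h t et; apply: h; rewrite et. Qed.

Lemma constituent_mod g N j j' : (j = j' %[mod N%:Z])%Z ->
  constituent g N j = constituent g N j'.
Proof.
move=> e; rewrite /constituent; congr xget; apply/seteqP; split=> p.
- exact: is_constituent_mod.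
- exact: is_constituent_mod.
Qed.

Lemma min_periodP g : quasi_polynomial g -> is_period g (min_period g).
Proof.
move=> [N hN].
have ex : exists n, `[< is_period g n >] by exists N; apply/asboolP.
suff [] : [set N | is_period g N /\ forall M, is_period g M -> (N <= M)%N]
  (min_period g) by [].
apply: xgetPex; case: (ex_minnP ex) => m /asboolP hm le.
by exists m; split=> // M hM; apply/le/asboolP.
Qed.

Lemma is_period_gcd g a b : is_period g a -> is_period g b ->
  is_period g (gcdn a b).
Proof.
move=> ha hb; have [a0 hap] := ha; have [b0 hbp] := hb.
split=> [|j]; first by rewrite gcdn_gt0 a0.
exists (constituent g a j) => t /eqz_mod_exP [z ->].
have [u [v uv]] := Bezoutz a b.
set t' := _ + _.
(* By Bezout, [s] is congruent to [j] modulo [a] and to [t'] modulo [b], so it links the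
   constituents of the two periods. *)
pose s := j + (z * u) * a.
have sj : (s = j %[mod a])%Z by apply/eqz_mod_exP; exists (z * u).
have st : (t' = s %[mod b])%Z.
  apply/eqz_mod_exP; exists (z * v); rewrite /s /t'.
  have -> : (gcdn a b)%:Z = gcdz a b by [].
  by rewrite -uv; ring.
rewrite -(constituent_mod g sj) (constituentP hb t' _ (erefl _)).
rewrite (constituent_mod g st); congr (_.[_]).
exact: (constituent_uniq b0 a0 (constituentP hb s) (constituentP ha s)).
Qed.

Lemma quasi_eq_large g g' q0 : quasi_polynomial g -> quasi_polynomial g' ->
  (forall q : nat, (q0 < q)%N -> g q = g' q) -> g = g'.
Proof.
move=> [N hN] [N' hN'] h; apply/funext => t.
have [[N0 _] [N0' _]] := (hN, hN').
rewrite (constituentP hN t _ (erefl _)) (constituentP hN' t _ (erefl _)).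
congr (_.[_]).
(* From this index on, the points of the progression through [t] are natural numbers above [q0],
   even when [t] is negative. *)
apply: (@poly_eq_arith _ _ _ t%:~R (N * N') (q0 + `|t|).+1).
  by rewrite muln_gt0 N0.
move=> i le; have -> : t%:~R + (N * N')%:R * i%:R =
    (t + (N * N' * i)%N%:Z)%:~R :> C by rewrite intrD -!natrM.
rewrite -(constituentP hN t) -?(constituentP hN' t); last 2 first.
- by apply/eqz_mod_exP; exists (N * i)%N%:Z; rewrite -PoszM; congr (_ + Posz _); ring.
- by apply/eqz_mod_exP; exists (N' * i)%N%:Z; rewrite -PoszM; congr (_ + Posz _); ring.
have le2 : (i <= N * N' * i)%N by rewrite leq_pmull // muln_gt0 N0.
have -> : t + (N * N' * i)%N = absz (t + (N * N' * i)%N%:Z) by lia.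
by apply: h; lia.
Qed.

(** On one residue class modulo [M] the operator is the [d]-th power of a plain difference, so [u]
    is polynomial there; these polynomials also define the values at negative integers. *)
Lemma period_seq_extend d M (u : nat -> C) : (0 < M)%N ->
    (forall q, (M * d <= q)%N ->
      coef_apply (fun k => u (q - k)%N) (('X ^+ M - 1) ^+ d) = 0) ->
  exists2 g, is_period g M & forall q : nat, g q = u q.
Proof.
move=> M0 h.
have [p hp] : {p : nat -> {poly C} & forall j i, u (j + M * i)%N = (p j).[i%:R]}.
  apply: (@boolp.choice nat {poly C}
    (fun j p => forall i, u (j + M * i)%N = p.[i%:R])) => j.
  apply: (@diff_eq0_poly _ d) => i le.
  have := h (j + M * i)%N (leq_trans (leq_mul (leqnn M) le) (leq_addl _ _)).
  have -> : ('X^M - 1) ^+ d = (('X - 1) ^+ d) \Po 'X^M :> {poly C}.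
    by rewrite rmorphXn rmorphB /= comp_polyX rmorph1.
  rewrite coef_apply_comp_Xn => <-; apply: eq_coef_apply => k.
  rewrite size_exp_XsubC ltnS => lek; congr u.
  rewrite mulnBr addnBA ?leq_mul // ?(leq_trans lek) //; last first.
  by congr (_ - _)%N; rewrite mulnC.
exists (fun t => (p `|(t %% M)%Z|%N).[(t %/ M)%Z%:~R]).
  split=> // j; exists (p `|(j %% M)%Z|%N \Po (M%:R^-1 *: ('X - (j %% M)%Z%:~R%:P))).
  move=> t e; rewrite horner_comp !hornerE e; congr (_.[_]).
  rewrite {2}(divz_eq t M) e intrD addrK intrM -pmulrn mulrC mulfK //.
  by rewrite pnatr_eq0 -lt0n.
move=> q; rewrite modz_nat divz_nat -pmulrn -hp; congr u.
by rewrite addnC mulnC -divn_eq.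
Qed.

Lemma diff_eq0_period d m g : (0 < m)%N ->
    (forall t, coef_apply (fun k => g (t - k%:Z)) (('X ^+ m - 1) ^+ d) = 0) ->
  is_period g m.
Proof.
move=> m0 h; have mnz : m%:R != 0 :> C by rewrite pnatr_eq0 -lt0n.
have ex (t : int) : exists p : {poly C}, forall i : nat, g (t + (m * i)%N) = p.[i%:R].
  apply: (@diff_eq0_poly _ d) => i le.
  have := h (t + (m * i)%N).
  have -> : ('X^m - 1) ^+ d = (('X - 1) ^+ d) \Po 'X^m :> {poly C}.
    by rewrite rmorphXn rmorphB /= comp_polyX rmorph1.
  rewrite coef_apply_comp_Xn => <-; apply: eq_coef_apply => k.
  rewrite size_exp_XsubC ltnS => lek; congr g.
  by rewrite mulnBr -addrA; congr (_ + _); have := leq_trans lek le; nia.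
have [p hp] := boolp.choice ex.
split=> // j; exists (p j \Po (m%:R^-1 *: ('X - j%:~R%:P))) => t.
move=> /eqz_mod_exP [z ->].
rewrite horner_comp !hornerE intrD addrAC subrr add0r intrM -pmulrn (mulrC m%:R^-1) mulfK //.
have -> : g (j + z * m) = (p (j + z * m)).[0].
  by rewrite -[0]/(0%:R) -hp muln0 addr0.
(* So far each starting point only has a polynomial for the ray to its right. Two rays of the same
   class overlap from [i = |z|] on, which identifies their polynomials. *)
have -> : p (j + z * m) = p j \Po ('X + z%:~R%:P).
  apply: (@poly_eq_nat _ _ _ `|z|%N) => i le.
  rewrite horner_comp !hornerE -hp.
  have -> : i%:R + z%:~R = (absz (i%:Z + z))%:R :> C.
    have e : (absz (i%:Z + z))%:Z = i%:Z + z by lia.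
    by rewrite [RHS]pmulrn e intrD -pmulrn.
  by rewrite -hp; congr g; nia.
by rewrite horner_comp !hornerE.
Qed.

End Quasi.
Arguments constituentP {R g N} _ j _ _.

(** * Partition counts and their truncated generating functions *)

Section PartitionCounts.
Variables (K : numFieldType) (l : nat) (c : 'I_l -> nat).
Hypothesis c_gt0 : forall i, (0 < c i)%N.

(** Bounding the variables by [q] makes the type finite and loses no solution, because every [c i]
    is positive. *)
Definition count_sols (q : nat) : nat :=
  #|[pred a : {ffun 'I_l -> 'I_q.+1} | \sum_i c i * a i == q]%N|.

(** A polynomial stand-in for the power series [1 / partition_denom]: its coefficients are the right
    ones below [N]. *)
Definition count_gen (N : nat) : {poly K} :=
  \prod_i \sum_(a < N) 'X^(c i * a).

Definition partition_denom : {poly K} := \prod_i (1 - 'X^(c i)).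

Lemma card_sols N q : (q < N)%N ->
  #|[pred a : {ffun 'I_l -> 'I_N} | \sum_i c i * a i == q]%N| = count_sols q.
Proof.
move=> ltq; pose h (a : {ffun 'I_l -> 'I_q.+1}) : {ffun 'I_l -> 'I_N} :=
  [ffun i => widen_ord ltq (a i)].
have hi : injective h.
  move=> a b ab; apply/ffunP => i; apply/val_inj.
  by have := congr1 (fun f : {ffun _ -> _} => val (f i)) ab; rewrite !ffunE.
rewrite /count_sols -(card_imset _ hi); apply: eq_card => f.
rewrite [LHS]inE; apply/idP/imsetP => [|[a]]; last first.
  rewrite inE => /eqP ea ->; apply/eqP; rewrite -[RHS]ea.
  by apply: eq_bigr => i _; rewrite ffunE.
move=> /eqP ef; have le i : (f i < q.+1)%N.
  rewrite ltnS -ef (bigD1 i) //=; apply: leq_trans (leq_addr _ _).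
  by rewrite leq_pmull.
exists [ffun i => Ordinal (le i)].
  by rewrite inE -[X in _ == X]ef; apply/eqP/eq_bigr => i _; rewrite ffunE.
by apply/ffunP => i; apply/val_inj; rewrite !ffunE.
Qed.

Lemma coef_count_gen N q : (q < N)%N -> (count_gen N)`_q = (count_sols q)%:R.
Proof.
move=> ltq; rewrite /count_gen bigA_distr_bigA /= coef_sum.
have e (f : {ffun 'I_l -> 'I_N}) :
    (\prod_i 'X^(c i * f i) : {poly K})`_q = (\sum_i c i * f i == q)%N%:R.
  rewrite -(big_morph (fun k => 'X^k : {poly K}) (id1 := 1) (op1 := *%R)
             (op2 := addn) (id2 := 0%N)) ?expr0 //; last exact: exprD.
  by rewrite coefXn eq_sym.
under eq_bigr => f _ do rewrite e.
rewrite -natr_sum; congr _%:R.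
by rewrite -big_mkcond /= sum1_card card_sols.
Qed.

(** Truncation thus serves as reduction modulo ['X^N], where [count_gen] inverts the denominator. *)
Lemma take_poly_mulr N (p q : {poly K}) :
  take_poly N (p * take_poly N q) = take_poly N (p * q).
Proof.
by rewrite -[in RHS](poly_take_drop N q) mulrDr take_polyD mulrA take_polyMXn_0 ?addr0.
Qed.

Lemma take_denom_count_gen N : (0 < N)%N -> take_poly N (partition_denom * count_gen N) = 1.
Proof.
move=> N0; rewrite /partition_denom /count_gen -big_split /=.
apply: (big_ind (fun p => take_poly N p = 1)) => [|x y hx hy|i _].
- by rewrite take_poly_id // size_poly1.
- rewrite -take_poly_mulr hy mulr1 //.
- have -> : \sum_(a < N) 'X^(c i * a) = \sum_(a < N) ('X^(c i)) ^+ a :> {poly K}.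
    by apply: eq_bigr => a _; rewrite exprM.
  rewrite -opprB mulNr -subrX1 opprB -exprM -['X^(_ * _)]mul1r.
  have -> : (c i * N = (c i).-1 * N + N)%N by rewrite -mulSnr prednK.
  rewrite exprD mulrA -mulNr take_polyD take_polyMXn_0 addr0.
  by rewrite take_poly_id // size_poly1.
Qed.

End PartitionCounts.

(** * The Worpitzky identity and averaging *)

Section PartitionRecurrence.
Variables (K : numFieldType) (l : nat) (c : 'I_l -> nat).
Hypothesis c_gt0 : forall i, (0 < c i)%N.
Local Notation u := (fun q => (count_sols c q)%:R : K).
Local Notation denom := (@partition_denom K l c).

Lemma coef_mul_denom_count_gen (P : {poly K}) N q : (q < N)%N ->
  (P * denom * count_gen K c N)`_q = P`_q.
Proof.
move=> ltq; have N0 : (0 < N)%N by apply: leq_ltn_trans ltq.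
have := take_poly_mulr N P (denom * count_gen K c N).
rewrite take_denom_count_gen // mulr1 => /(congr1 (fun p : {poly K} => p`_q)).
by rewrite !coef_take_poly ltq mulrA.
Qed.

(** The denominator cancels the generating function and leaves [P], which has no coefficient of
    degree [q]. *)
Lemma denom_mul_eq0 (P : {poly K}) q :
    (size P <= q)%N -> (size (P * denom)%R <= q.+1)%N ->
  coef_apply (fun k => u (q - k)%N) (P * denom) = 0.
Proof.
move=> leP le.
rewrite (eq_coef_apply (G := fun k => (count_gen K c q.+1)`_(q - k))).
  by rewrite -coef_mul_apply // coef_mul_denom_count_gen // nth_default.
by move=> k _; rewrite coef_count_gen // ltnS leq_subr.
Qed.

Lemma denom_dvd_comp_Xn n : exists E : {poly K},
  denom \Po 'X^n = E * denom.
Proof.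
exists (\prod_i \sum_(j < n) ('X^(c i)) ^+ j).
rewrite /partition_denom rmorph_prod -big_split /=; apply: eq_bigr => i _.
rewrite rmorphB rmorph1 /= comp_Xn_poly -exprM mulnC exprM.
by rewrite -opprB subrX1 -mulNr opprB mulrC.
Qed.

(** Factor by factor, since each [c i] divides the product of all. The least common multiple would
    do as well; any period suffices to show that the counts are quasi-polynomial. *)
Lemma denom_dvd_period : exists E : {poly K},
  ('X^(\prod_i c i) - 1) ^+ l = E * denom.
Proof.
exists (\prod_i - \sum_(j < (\prod_(i' | i' != i) c i')%N) ('X^(c i)) ^+ j).
rewrite /partition_denom -big_split /=.
have <- : \prod_(i < l) ('X^(\prod_i c i) - 1) = ('X^(\prod_i c i) - 1) ^+ l :> {poly K}.
  by rewrite prodr_const card_ord.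
apply: eq_bigr => i _; rewrite [in LHS](bigD1 i) //= exprM subrX1.
by rewrite mulNr -mulrN opprB mulrC.
Qed.

Lemma size_denom : (0 < l)%N -> (1 < size denom)%N.
Proof.
move=> l0; rewrite /partition_denom size_prod => [|i _]; last first.
  by rewrite -oppr_eq0 opprB -size_poly_eq0 size_XnsubC.
have s i : size (1 - 'X^(c i) : {poly K}) = (c i).+1.
  by rewrite -size_polyN opprB size_XnsubC.
under eq_bigr => i _ do rewrite s -addn1.
rewrite big_split /= sum1_card cardE -cardE card_ord -addSn addnK ltnS.
rewrite (bigD1 (Ordinal l0)) //=; apply: leq_trans (leq_addr _ _); exact: c_gt0.
Qed.

(* The Worpitzky identity says that the numerator [Q] multiplies the generating
   function [1 / denom] to the one of [q ^ d], a fraction with denominator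
   [('X - 1) ^+ d.+1]. *)
Lemma worpitzky_dvd d (Q : {poly K}) :
    (forall N q, (q < N)%N -> (Q * count_gen K c N)`_q = q%:R ^+ d) ->
  exists T, ('X - 1) ^+ d.+1 * Q = T * denom.
Proof.
move=> hQ.
(* Large enough for both sides of the claim to be their own truncations, so that a congruence modulo
   ['X^N] is an equality. *)
pose N := ((size (('X - 1) ^+ d.+1 * Q)%R + (d.+1 + size denom)).+1)%N.
pose P : {poly K} := \poly_(q < N) (q%:R ^+ d).
pose T := take_poly N (('X - 1) ^+ d.+1 * P).
have sT : (size T <= d.+1)%N.
  apply/leq_sizeP => q leq; rewrite coef_take_poly; case: ltnP => // ltq.
  have sz : (size (('X - 1) ^+ d.+1 : {poly K}) <= q.+1)%N.
    by rewrite size_exp_XsubC.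
  rewrite coef_mul_apply //.
  rewrite -[RHS](diff_poly_size (d := d.+1) (p := 'X^d) _ q%:R); last first.
    by rewrite size_polyXn.
  apply: eq_coef_apply => k ltk; rewrite coef_poly (leq_ltn_trans (leq_subr _ _)) //.
  by rewrite hornerXn natrB // -ltnS (leq_trans ltk).
exists T.
have e1 : take_poly N (Q * count_gen K c N) = P.
  apply/polyP => q; rewrite coef_take_poly coef_poly.
  by case: ltnP => // ltq; apply: hQ.
have e : take_poly N (('X - 1) ^+ d.+1 * Q) = take_poly N (T * denom).
  rewrite (mulrC T) take_poly_mulr mulrA -[in RHS]e1 take_poly_mulr.
  apply/polyP => q; rewrite !coef_take_poly; case: ltnP => // ltq.
  by rewrite -(coef_mul_denom_count_gen _ ltq); congr (polyseq _)`_q; ring.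
rewrite take_poly_id in e; last by rewrite /N; lia.
rewrite take_poly_id in e => //.
apply: leq_trans (size_polyMleq _ _) _; apply: leq_trans (leq_pred _) _.
by apply: leqW; apply: leq_trans (leq_addl _ _); apply: leq_add.
Qed.

End PartitionRecurrence.

(** * Shift operators and averages *)

Section Average.
Variable R : realType.
Local Notation C := (R[i]).
Implicit Types (g : int -> C) (P : {poly C}).

(** The genuine shift, which moves the residue class along with the argument; [Sbar_poly] keeps the
    class of [t]. *)
Definition shift_poly P g (t : int) : C := coef_apply (fun k => g (t - k%:Z)) P.

Definition shift_constituent P g N (j : int) : {poly C} :=
  \sum_(k < size P) P`_k *: (constituent g N (j - k%:Z) \Po ('X - k%:R%:P)).

Lemma is_constituent_shift P g N j : is_period g N ->
  is_constituent (shift_poly P g) N j (shift_constituent P g N j).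
Proof.
move=> hN t /eqz_mod_exP [z et]; rewrite horner_sum; apply: eq_bigr => k _.
rewrite hornerZ horner_comp !hornerE; congr (_ * _).
rewrite (constituentP hN (j - (k : nat)%:Z) (t - k%:Z)) ?intrD ?rmorphN //.
by apply/eqz_mod_exP; exists z; rewrite et addrAC.
Qed.

Lemma is_period_shift P g N : is_period g N -> is_period (shift_poly P g) N.
Proof.
move=> hN; split=> [|j]; first by case: hN.
by exists (shift_constituent P g N j); apply: is_constituent_shift.
Qed.

Lemma shift_poly_mul P Q g t :
  shift_poly (P * Q) g t = shift_poly P (shift_poly Q g) t.
Proof.
rewrite /shift_poly coef_apply_mul; apply: eq_coef_apply => k _.
by apply: eq_coef_apply => j _; rewrite PoszD opprD addrA.
Qed.

Lemma int_periodic (T : Type) (h : int -> T) (g : int) :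
  (forall j, h (j + g) = h j) -> forall j z, h (j + z * g) = h j.
Proof.
move=> e j; elim/int_ind => [|n IH|n IH].
- by rewrite mul0r addr0.
- by rewrite intS mulrDl mul1r addrCA addrC e IH.
- by rewrite -e -[RHS]IH; congr h; rewrite intS; ring.
Qed.

Section AverageLemmas.
Variables (L : int -> C) (g : nat).
Hypothesis qL : quasi_polynomial L.
Local Notation N := (min_period L).

Definition average_constituent (j : int) : {poly C} :=
  N%:R^-1 *: \sum_(0 <= i < N) constituent L N (j - i%:Z * g%:Z).

Lemma average_constituentE t : average g L t = (average_constituent t).[t%:~R].
Proof. by rewrite /average_constituent hornerZ horner_sum. Qed.

Lemma average_constituent_mod j z :
  average_constituent (j + z * g%:Z) = average_constituent j.
Proof.
have [N0 _] := min_periodP qL.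
apply: (int_periodic (h := average_constituent)) => {z}j; congr (_ *: _).
(* Moving [j] by [g] permutes the [N] summands cyclically, as constituents depend on their index
   modulo [N] only. *)
have key (V : nmodType) (h : int -> V) n : h (-1) = h (n%:Z - 1) ->
    \sum_(0 <= i < n) h (i%:Z - 1) = \sum_(0 <= i < n) h i.
  case: n => [|n] e; first by rewrite !big_geq.
  rewrite big_nat_recl // big_nat_recr //= [LHS]addrC sub0r e; congr (_ + h _).
    by apply: eq_bigr => i _; congr h; rewrite intS; ring.
  by rewrite intS; ring.
rewrite -(key _ (fun i => constituent L N (j - i * g%:Z))).
  by apply: eq_bigr => i _; congr constituent; ring.
by apply: constituent_mod; apply/eqz_mod_exP; exists g%:Z; ring.
Qed.

Lemma is_constituent_average j :
  is_constituent (average g L) g j (average_constituent j).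
Proof.
by move=> t /eqz_mod_exP [z ->]; rewrite average_constituentE average_constituent_mod.
Qed.

Lemma shift_poly_average (P : {poly C}) m d : (0 < m)%N -> g = gcdn m N ->
    (forall t, shift_poly (('X^m - 1) ^+ d * (P \Po 'X^m)) L t = 0) ->
  is_period (shift_poly (P \Po 'X^m) L) g /\
  forall t, shift_poly (P \Po 'X^m) L t = Sbar_poly (P \Po 'X^m) (average g L) t.
Proof.
move=> m0 eg h; set F := P \Po 'X^m; have hN := min_periodP qL.
have [N0 _] := hN; have g0 : (0 < g)%N by rewrite eg gcdn_gt0 m0.
have hg : is_period (shift_poly F L) g.
  rewrite eg; apply: is_period_gcd (is_period_shift _ hN).
  by apply: (diff_eq0_period (d := d) m0) => t; rewrite -(h t) shift_poly_mul.
split=> // t.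
have qA : quasi_polynomial (average g L).
  by exists g; split=> // j; exists (average_constituent j); apply: is_constituent_average.
have hA := min_periodP qA; have [A0 _] := hA.
have -> : Sbar_poly F (average g L) t =
    coef_apply (fun k => (average_constituent t).[(t - k%:Z)%:~R]) F.
  apply: eq_bigr => k _; congr (_ * _.[_]).
  exact: (constituent_uniq A0 g0 (constituentP hA t) (@is_constituent_average t)).
have [z ez] : exists z : nat, m = (z * g)%N.
  by exists (m %/ g)%N; rewrite divnK // eg dvdn_gcdl.
(* Period [g] allows the value at [t] to be computed from the class of [t - i * g] for any [i],
   hence also as the mean over [i < N]. *)
have e i : shift_poly F L t = (shift_constituent F L N (t - i%:Z * g%:Z)).[t%:~R].
  rewrite (constituentP hg t _ (erefl _)).
  rewrite -(@constituent_mod _ (shift_poly F L) g (t - i%:Z * g%:Z)).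
    congr (_.[_]); apply: constituent_uniq g0 N0 (constituentP hg _) _.
    exact: is_constituent_shift.
  by apply/eqz_mod_exP; exists (- i%:Z); rewrite mulNr.
rewrite /F coef_apply_comp_Xn -/F.
rewrite (eq_coef_apply (G := fun k => N%:R^-1 *
   \sum_(0 <= i < N) (constituent L N (t - i%:Z * g%:Z - (k * m)%N%:Z)).[(t - (k * m)%N%:Z)%:~R])).
  rewrite coef_apply_scale /coef_apply.
  under eq_bigr do rewrite mulr_sumr.
  rewrite exchange_big /=.
  rewrite (eq_bigr (fun=> shift_poly F L t)) => [|i _].
    rewrite sumr_const_nat subn0 -[X in _ = _ * X]mulr_natl mulKf //.
    by rewrite pnatr_eq0 -lt0n.
  rewrite (e i) /shift_constituent horner_sum.
  rewrite -[LHS]/(coef_apply (fun k => (constituent L N (t - i%:Z * g%:Z - (k * m)%N%:Z)).[(t - (k * m)%N%:Z)%:~R]) P).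
  rewrite -(coef_apply_comp_Xn (fun k => (constituent L N (t - i%:Z * g%:Z - k%:Z)).[(t - k%:Z)%:~R])).
  apply: eq_bigr => k _; rewrite hornerZ horner_comp !hornerE.
  by rewrite intrD rmorphN.
move=> k _.
(* Since [m = z * g], the class of [t] may be replaced by that of [t - k * m]: this is where the
   constituent action becomes the genuine shift. *)
rewrite -(average_constituent_mod t (- (k * z)%N%:Z)).
rewrite /average_constituent hornerZ horner_sum.
have <- : t - (k * m)%N%:Z = t + - (k * z)%N%:Z * g%:Z.
  by rewrite ez mulnA PoszM mulNr.
by congr (_ * _); apply: eq_bigr => i _; congr (_.[_]); congr constituent; ring.
Qed.

End AverageLemmas.
End Average.

(** * Root systems and Weyl groups *)

Lemma int_ge1 (R : realType) (x : R) : x \is a Num.int -> 0 < x -> 1 <= x.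
Proof.
by move=> /intrP [m ->]; rewrite ltr0z ler1z; lia.
Qed.

Section Dot.
Variables (R : realType) (l : nat).
Local Notation V := 'rV[R]_l.
Implicit Types x y z a : V.

Lemma dotE x y : dot x y = \sum_i x 0 i * y 0 i.
Proof. by rewrite /dot mxE; apply: eq_bigr => i _; rewrite mxE. Qed.

Lemma dotC x y : dot x y = dot y x.
Proof. by rewrite !dotE; apply: eq_bigr => i _; rewrite mulrC. Qed.

Lemma dotDl x y z : dot (x + y) z = dot x z + dot y z.
Proof. by rewrite /dot mulmxDl mxE. Qed.

Lemma dotZl k x z : dot (k *: x) z = k * dot x z.
Proof. by rewrite /dot -scalemxAl mxE. Qed.

Lemma dotDr x y z : dot z (x + y) = dot z x + dot z y.
Proof. by rewrite !(dotC z) dotDl. Qed.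

Lemma dotZr k x z : dot z (k *: x) = k * dot z x.
Proof. by rewrite !(dotC z) dotZl. Qed.

Lemma dotNl x z : dot (- x) z = - dot x z.
Proof. by rewrite -scaleN1r dotZl mulN1r. Qed.

Lemma dotNr x z : dot z (- x) = - dot z x.
Proof. by rewrite !(dotC z) dotNl. Qed.

Lemma dotBl x y z : dot (x - y) z = dot x z - dot y z.
Proof. by rewrite dotDl dotNl. Qed.

Lemma dotBr x y z : dot z (x - y) = dot z x - dot z y.
Proof. by rewrite dotDr dotNr. Qed.

Lemma dot0l z : dot 0 z = 0.
Proof. by rewrite -(scale0r z) dotZl mul0r. Qed.

Lemma dot0r z : dot z 0 = 0.
Proof. by rewrite dotC dot0l. Qed.

Lemma dot_suml (I : Type) (r : seq I) (P : pred I) (F : I -> V) z :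
  dot (\sum_(i <- r | P i) F i) z = \sum_(i <- r | P i) dot (F i) z.
Proof. exact: (big_morph (fun x => dot x z) (fun x y => dotDl x y z) (dot0l z)). Qed.

Lemma dot_sumr (I : Type) (r : seq I) (P : pred I) (F : I -> V) z :
  dot z (\sum_(i <- r | P i) F i) = \sum_(i <- r | P i) dot z (F i).
Proof. by rewrite dotC dot_suml; apply: eq_bigr => i _; rewrite dotC. Qed.

Lemma dot_ge0 x : 0 <= dot x x.
Proof. by rewrite dotE; apply: sumr_ge0 => i _; rewrite -expr2 sqr_ge0. Qed.

Lemma dot_eq0 x : dot x x = 0 -> x = 0.
Proof.
move=> /eqP; rewrite dotE psumr_eq0 => [|i _]; last by rewrite -expr2 sqr_ge0.
move=> /allP h; apply/rowP => i; rewrite mxE.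
by have := h i (mem_index_enum i); rewrite -expr2 sqrf_eq0 => /eqP.
Qed.

Lemma dot_gt0 x : x <> 0 -> 0 < dot x x.
Proof. by move=> nx; rewrite lt_neqAle dot_ge0 andbT eq_sym; apply/eqP => /dot_eq0. Qed.

Lemma dot_corootr x a : dot x (coroot a) = 2 / dot a a * dot x a.
Proof. exact: dotZr. Qed.

Lemma reflectionD a x y : reflection a (x + y) = reflection a x + reflection a y.
Proof. by rewrite /reflection dotDl scalerDl opprD addrACA. Qed.

Lemma reflectionZ a k x : reflection a (k *: x) = k *: reflection a x.
Proof. by rewrite /reflection dotZl scalerBr scalerA. Qed.

Section Nonzero.
Variable a : V.
Hypothesis nza : a <> 0.

Lemma dot_self_coroot : dot a (coroot a) = 2.
Proof. by rewrite dot_corootr divfK // gt_eqF // dot_gt0. Qed.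

Lemma reflection_self : reflection a a = - a.
Proof.
by rewrite /reflection dot_self_coroot (scalerDl a 1 1) scale1r opprD addrA subrr sub0r.
Qed.

Lemma dot_reflection x y : dot (reflection a x) (reflection a y) = dot x y.
Proof.
have n0 := dot_gt0 nza; rewrite /reflection !(dotBl, dotBr, dotZl, dotZr).
rewrite (dotC a y); set t := dot a a in n0 *.
by field; rewrite gt_eqF.
Qed.

Lemma reflectionK : involutive (reflection a).
Proof.
move=> x; rewrite /reflection dotBl dotZl dot_self_coroot -addrA -opprD -scalerDl.
set d := dot x _; have -> : d + (d - d * 2) = 0 by ring.
by rewrite scale0r subr0.
Qed.

End Nonzero.

Lemma coroot_isometry (f : V -> V) a :
    (forall x y, dot (f x) (f y) = dot x y) ->
    (forall k x, f (k *: x) = k *: f x) ->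
  coroot (f a) = f (coroot a).
Proof. by move=> fd fZ; rewrite /coroot fd fZ. Qed.

Lemma reflection_isometry (f : V -> V) a x :
    (forall x y, dot (f x) (f y) = dot x y) ->
    (forall k x, f (k *: x) = k *: f x) ->
    (forall x y, f (x + y) = f x + f y) ->
  reflection (f a) (f x) = f (reflection a x).
Proof.
move=> fd fZ fD; rewrite /reflection coroot_isometry // fd fD.
by rewrite -scaleN1r -[in RHS]scaleN1r !fZ.
Qed.

Lemma corootN a : coroot (- a) = - coroot a.
Proof. by rewrite /coroot dotNl dotNr opprK scalerN. Qed.

End Dot.

Section RootSystem.
Variables (R : realType) (l : nat).
Local Notation V := 'rV[R]_l.
Variables (Phi : set V) (Delta : 'I_l -> V).
Hypothesis Phi_root : root_system Phi.
Hypothesis Delta_simple : simple_roots Phi Delta.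
Local Notation W := (weyl_group Phi).
Local Notation pos := (positive_roots Phi Delta).
Local Notation s_ i := (reflection (Delta i)).
Implicit Types (a b x y : V) (w : V -> V).

Lemma root_nz a : Phi a -> a <> 0.
Proof. by move=> Pa a0; apply: (root_neq0 Phi_root); rewrite -a0. Qed.

Lemma root_opp a : Phi a -> Phi (- a).
Proof.
move=> Pa; rewrite -(reflection_self (root_nz Pa)).
exact: (root_reflection Phi_root).
Qed.

Lemma simple_root i : Phi (Delta i).
Proof. by case: Delta_simple. Qed.

Lemma Delta_coord x : exists k : 'I_l -> R, x = \sum_i k i *: Delta i.
Proof.
have [bas _ _] := Delta_simple.
exists (fun i => coord [tuple Delta i | i < l] i x).
rewrite {1}(coord_basis bas (memvf x)); apply: eq_bigr => i _.
by rewrite -tnth_nth tnth_mktuple.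
Qed.

Lemma Delta_free (k : 'I_l -> R) : \sum_i k i *: Delta i = 0 -> forall i, k i = 0.
Proof.
have [bas _ _] := Delta_simple; have fr := basis_free bas.
move=> e; move/freeP: fr => /(_ k); apply; rewrite -[RHS]e; apply: eq_bigr => i _.
by rewrite -tnth_nth tnth_mktuple.
Qed.

Lemma coweight_exists (v : 'I_l -> R) : exists x, forall i, dot (Delta i) x = v i.
Proof.
pose M : 'M[R]_l := \matrix_(i, j) Delta i 0 j.
have rf : row_free M.
  rewrite -kermx_eq0; apply/rowV0P => u /sub_kermxP uM.
  apply/rowP => i; rewrite mxE; apply: (Delta_free (k := fun i => u 0 i)).
  rewrite -[RHS]uM; apply/rowP => j; rewrite summxE mxE.
  by apply: eq_bigr => k _; rewrite !mxE.
have uM : M \in unitmx by rewrite -row_free_unit.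
exists ((invmx M *m (\col_i v i))^T) => i.
rewrite /dot trmxK mulmxA.
have -> : Delta i = row i M by apply/rowP => j; rewrite !mxE.
by rewrite -row_mul mulmxV // -row_mul mul1mx !mxE.
Qed.

Definition coweight (v : 'I_l -> R) : V := projT1 (cid (coweight_exists v)).

Lemma dot_coweight v i : dot (Delta i) (coweight v) = v i.
Proof. by rewrite /coweight; case: cid. Qed.

Lemma dot_Delta_inj x y : (forall i, dot (Delta i) x = dot (Delta i) y) -> x = y.
Proof.
move=> e; apply/eqP; rewrite -subr_eq0; apply/eqP/dot_eq0.
have [k ek] := Delta_coord (x - y); rewrite {1}ek dot_suml big1 // => i _.
by rewrite dotZl dotBr e subrr mulr0.
Qed.

(** Coordinates on the simple roots, read off by pairing with the fundamental coweights, which makes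
    their linearity immediate. *)
Definition rcoord a (i : 'I_l) : R := dot a (coweight (fun j => (j == i)%:R)).

Lemma rcoord_comb (k : 'I_l -> R) i : rcoord (\sum_j k j *: Delta j) i = k i.
Proof.
rewrite /rcoord dot_suml (bigD1 i) //= dotZl dot_coweight eqxx mulr1.
by rewrite big1 ?addr0 // => j /negPf ne; rewrite dotZl dot_coweight ne mulr0.
Qed.

Lemma rcoordE a : a = \sum_i rcoord a i *: Delta i.
Proof.
have [k ->] := Delta_coord a; apply: eq_bigr => i _; by rewrite rcoord_comb.
Qed.

Lemma rcoord_pos a i : nonneg_comb Delta a -> rcoord a i \is a Num.nat.
Proof. by move=> [k ->]; rewrite rcoord_comb natr_nat. Qed.

Lemma rcoord_ge0 a i : nonneg_comb Delta a -> 0 <= rcoord a i.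
Proof. by move=> /(rcoord_pos i)/natrP [k ->]. Qed.

Lemma rcoordN a i : rcoord (- a) i = - rcoord a i.
Proof. exact: dotNl. Qed.

Lemma pos_or a : Phi a -> pos a \/ pos (- a).
Proof.
move=> Pa; have [_ _ h] := Delta_simple.
by case: (h a Pa) => c; [left|right]; split=> //; apply: root_opp.
Qed.

Lemma pos_opp a : pos a -> ~ pos (- a).
Proof.
move=> [Pa na] [_ nna]; apply: (root_nz Pa); rewrite (rcoordE a) big1 // => i _.
have := rcoord_ge0 i na; have := rcoord_ge0 i nna; rewrite rcoordN => h1 h2.
have /eqP -> : rcoord a i == 0 by rewrite eq_le h2 andbT -oppr_ge0.
by rewrite scale0r.
Qed.

Lemma pos_rcoord a i : Phi a -> 0 < rcoord a i -> pos a.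
Proof.
move=> Pa h; case: (pos_or Pa) => // -[_ n].
by have := rcoord_ge0 i n; rewrite rcoordN; lra.
Qed.

Lemma nonneg_Delta i : nonneg_comb Delta (Delta i).
Proof.
exists (fun j => (j == i)%N : nat); rewrite (bigD1 i) //= eqxx scale1r.
by rewrite big1 ?addr0 // => j /negPf ->; rewrite scale0r.
Qed.

Lemma pos_Delta i : pos (Delta i).
Proof. by split; [apply: simple_root|apply: nonneg_Delta]. Qed.

Lemma rcoord_Delta i j : rcoord (Delta i) j = (i == j)%:R.
Proof. exact: dot_coweight. Qed.

(* A positive root other than [Delta i] has another positive coordinate, which
   the reflection [s_ i] does not change. *)
Lemma pos_simple_reflection a i : pos a -> a <> Delta i -> pos (s_ i a).
Proof.
move=> [Pa na] ne.
have Ps : Phi (s_ i a) by apply: (root_reflection Phi_root) => //; apply: simple_root.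
have [[j nj p]|h] := pselect (exists2 j, j != i & 0 < rcoord a j).
  apply: (@pos_rcoord _ j) => //; rewrite /reflection /rcoord dotBl dotZl.
  by rewrite -!/(rcoord _ _) rcoord_Delta eq_sym (negPf nj) mulr0 subr0.
have e : a = rcoord a i *: Delta i.
  rewrite {1}(rcoordE a) (bigD1 i) //= big1 ?addr0 // => j nj.
  suff -> : rcoord a j = 0 by rewrite scale0r.
  have := rcoord_ge0 j na; rewrite le_eqVlt => /orP [/eqP //|p].
  by case: h; exists j.
have Pe := Pa; rewrite e in Pe.
have := rcoord_ge0 i na.
case: (root_reduced Phi_root (simple_root i) Pe) => r; rewrite r.
- by case: ne; rewrite e r scale1r.
- lra.
Qed.

Lemma weyl_props w : W w ->
  [/\ forall x y, dot (w x) (w y) = dot x y, forall k x, w (k *: x) = k *: w x,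
      forall x y, w (x + y) = w x + w y & forall a, Phi a -> Phi (w a)].
Proof.
elim=> [//|a {}w Pa _ [d z s r]].
have nz := root_nz Pa; split=> /= *.
- by rewrite dot_reflection.
- by rewrite z reflectionZ.
- by rewrite s reflectionD.
- by apply: (root_reflection Phi_root); rewrite // ; apply: r.
Qed.

Lemma weyl_dot w : W w -> forall x y, dot (w x) (w y) = dot x y.
Proof. by case/weyl_props. Qed.
Lemma weylZ w : W w -> forall k x, w (k *: x) = k *: w x.
Proof. by case/weyl_props. Qed.
Lemma weylD w : W w -> forall x y, w (x + y) = w x + w y.
Proof. by case/weyl_props. Qed.
Lemma weyl_root w : W w -> forall a, Phi a -> Phi (w a).
Proof. by case/weyl_props. Qed.
Lemma weylN w : W w -> forall x, w (- x) = - w x.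
Proof. by move=> Ww x; rewrite -scaleN1r weylZ // scaleN1r. Qed.
Lemma weyl_sum w : W w -> forall (I : Type) (r : seq I) (F : I -> V),
  w (\sum_(i <- r) F i) = \sum_(i <- r) w (F i).
Proof.
move=> Ww I r F; have w0 : w 0 = 0 by have := weylZ Ww 0 0; rewrite !scale0r.
exact: (big_morph w (weylD Ww) w0).
Qed.

Lemma weyl_comp w w' : W w -> W w' -> W (w \o w').
Proof. by move=> Ww Ww'; elim: Ww => // a v Pa _ IH; apply: (weyl_refl Pa IH). Qed.

Lemma weyl_reflection a : Phi a -> W (reflection a).
Proof. by move=> Pa; apply: (weyl_refl Pa (weyl_id _)). Qed.

Lemma weyl_inv w : W w -> exists2 w', W w' & cancel w w' /\ cancel w' w.
Proof.
elim=> [|a {}w Pa _ [w' Ww' [K K']]]; first by exists id => //; apply: weyl_id.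
exists (w' \o reflection a); first exact: weyl_comp Ww' (weyl_reflection Pa).
have nz := root_nz Pa.
by split=> x /=; [rewrite reflectionK // K|rewrite K' reflectionK].
Qed.

(** * Words in the simple reflections *)

Fixpoint word (s : seq 'I_l) : V -> V :=
  if s is i :: s' then s_ i \o word s' else id.

Lemma word_cat s t : word (s ++ t) = word s \o word t.
Proof. by elim: s => //= i s ->. Qed.

Lemma weyl_word_in s : W (word s).
Proof.
by elim: s => [|i s IH] /=; [apply: weyl_id|apply: weyl_refl IH; apply: simple_root].
Qed.

Lemma reflection_conj w a : W w -> forall x,
  reflection (w a) (w x) = w (reflection a x).
Proof.
move=> Ww x; apply: reflection_isometry; [exact: weyl_dot|exact: weylZ|exact: weylD].
Qed.

(** The sum of the fundamental coweights; pairing a root with it gives the height. *)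
Definition rhov : V := coweight (fun=> 1).

Lemma dot_rhov a : dot a rhov = \sum_i rcoord a i.
Proof.
rewrite [in LHS](rcoordE a) dot_suml; apply: eq_bigr => i _.
by rewrite dotZl dot_coweight mulr1.
Qed.

Lemma reflectionN a : reflection (- a) = reflection a.
Proof. by apply/funext => x; rewrite /reflection corootN dotNr scalerN scaleNr opprK. Qed.

(** Induction on the height. A positive root that is not simple has a positive product with some
    [Delta i]; then [s_ i a] is positive and lower, by at least 1 by integrality, and its reflection
    is conjugate to that of [a] under [s_ i]. *)
Lemma pos_reflection_word a : pos a -> exists s, reflection a = word s.
Proof.
have [n le] : exists n : nat, dot a rhov <= n%:R.
  exists (Num.bound `|dot a rhov|).
  by apply/ltW/(le_lt_trans (ler_norm _))/archi_boundP.
elim: n a le => [|n IH] a le pa; have [Pa na] := pa.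
  exfalso; apply: (root_nz Pa); rewrite (rcoordE a) big1 // => i _.
  suff -> : rcoord a i = 0 by rewrite scale0r.
  apply/eqP; rewrite eq_le rcoord_ge0 // andbT.
  apply: le_trans le; rewrite dot_rhov (bigD1 i) //= lerDl.
  by apply: sumr_ge0 => j _; apply: rcoord_ge0.
have [[i ei]|ne] := pselect (exists i, a = Delta i); first by exists [:: i]; rewrite ei.
have [i p] : exists i, 0 < dot a (Delta i).
  apply/not_existsP => h; have := dot_gt0 (root_nz Pa).
  rewrite {2}(rcoordE a) dot_sumr ltNge; case/negP; apply: sumr_le0 => i _.
  rewrite dotZr mulr_ge0_le0 ?rcoord_ge0 // leNgt; apply/negP; exact: h.
have nz := dot_gt0 (root_nz (simple_root i)).
have Pi := simple_root i.
have ps : pos (s_ i a) by apply: pos_simple_reflection => // e; apply: ne; exists i.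
have [||s es] := IH (s_ i a) => //.
  rewrite /reflection dotBl dotZl dot_coweight mulr1.
  have := int_ge1 (root_crystallographic Phi_root (simple_root i) Pa).
  rewrite dot_corootr => /(_ _) => h.
  have : 1 <= 2 / dot (Delta i) (Delta i) * dot a (Delta i).
    by apply: h; rewrite mulr_gt0 // divr_gt0.
  move: le; rewrite -natr1; lra.
exists (i :: s ++ [:: i]); rewrite /= word_cat -es /=; apply/funext => x /=.
have Wi := weyl_reflection Pi.
by rewrite (reflection_conj _ Wi) (reflectionK (root_nz Pi)).
Qed.

Lemma weyl_word w : W w -> exists s, w = word s.
Proof.
elim=> [|a {}w Pa _ [s ->]]; first by exists [::].
have [t e] : exists t, reflection a = word t.
  case: (pos_or Pa) => /pos_reflection_word //.
  by rewrite reflectionN.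
by exists (t ++ s); rewrite word_cat e.
Qed.

(** Some letter [j] of the word is the one that turns the image of [Delta i] negative. Just before
    it the image must be [Delta j], so by conjugation that letter cancels against the final
    [s_ i]. *)
Lemma exchange s i : pos (- word s (Delta i)) ->
  exists2 t, (size t < size s)%N & word s \o s_ i = word t.
Proof.
elim: s => [|j s IH] /= h; first by case: (pos_opp (pos_Delta i)).
have Ps : Phi (word s (Delta i)) by apply: weyl_root (weyl_word_in s) _ (simple_root i).
case: (pos_or Ps) => p; last first.
  by have [t st et] := IH p; exists (j :: t) => //=; rewrite -et.
exists s => //.
have [e|ne] := pselect (word s (Delta i) = Delta j); last first.
  by case: (pos_opp (pos_simple_reflection p ne)).
apply/funext => x /=; rewrite -e -(reflection_conj _ (weyl_word_in s)).
by rewrite reflectionK; last exact: root_nz.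
Qed.

Lemma weyl_pos_id w : W w -> (forall i, pos (w (Delta i))) -> w = id.
Proof.
move=> /weyl_word [s ->].
have [n le] : exists n, (size s <= n)%N by exists (size s).
elim: n s le => [|n IH] s le h; first by case: s le h.
case/lastP: s le h => // s i; rewrite size_rcons -cats1 word_cat => le h.
have p : pos (- word s (Delta i)).
  have := h i; rewrite /= (reflection_self (root_nz (simple_root i))).
  by rewrite (weylN (weyl_word_in s)).
have [t lt et] := exchange p.
have et' : word s \o word [:: i] = word t by rewrite -et.
rewrite et' in h *; apply: IH => //; lia.
Qed.

(** Signs are absorbed by opposite roots and multiplicities by repetition, so the number of summands
    becomes a quantity to induct on. *)
Lemma coroot_latticeP x : coroot_lattice Phi x <->
  exists t : seq V, {in t, forall a, Phi a} /\ x = \sum_(a <- t) coroot a.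
Proof.
split=> [[s [z [hs ->]]]|[t [ht ->]]]; last first.
  exists (undup t), (fun a => (count_mem a t)%:Z); split.
    by move=> a; rewrite mem_undup; apply: ht.
  rewrite -big_undup_iterop_count /=; apply: eq_bigr => a _.
  by rewrite -pmulrn scaler_nat.
elim: s hs => [|a s IH] hs.
  by exists [::]; split=> //; rewrite !big_nil.
have [|t [ht et]] := IH; first by move=> b bs; apply: hs; rewrite inE bs orbT.
have Pa : Phi a by apply: hs; rewrite inE eqxx.
rewrite big_cons et.
case: (z a) => n.
- exists (nseq n a ++ t); split.
    by move=> b; rewrite mem_cat mem_nseq => /orP [/andP [_ /eqP ->]|/ht].
  by rewrite big_cat big_nseq -Monoid.iteropE -pmulrn scaler_nat.
- exists (nseq n.+1 (- a) ++ t); split.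
    move=> b; rewrite mem_cat mem_nseq => /orP [/andP [_ /eqP ->]|/ht] //.
    exact: root_opp.
  rewrite big_cat big_nseq -Monoid.iteropE -[iterop _ _ _ _]/(_ *+ n.+1) corootN NegzE rmorphN /= -pmulrn.
  by rewrite scaleNr scaler_nat -mulNrn.
Qed.

Lemma coroot_lattice0 : coroot_lattice Phi 0.
Proof. by apply/coroot_latticeP; exists [::]; rewrite big_nil. Qed.

Lemma coroot_latticeD x y :
  coroot_lattice Phi x -> coroot_lattice Phi y -> coroot_lattice Phi (x + y).
Proof.
move=> /coroot_latticeP [s [hs ->]] /coroot_latticeP [t [ht ->]].
apply/coroot_latticeP; exists (s ++ t); rewrite big_cat; split=> // a.
by rewrite mem_cat => /orP [/hs|/ht].
Qed.

Lemma coroot_latticeN x : coroot_lattice Phi x -> coroot_lattice Phi (- x).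
Proof.
move=> /coroot_latticeP [t [ht ->]]; apply/coroot_latticeP.
exists (map -%R t); split=> [a /mapP [b bt ->]|]; first exact: root_opp (ht _ bt).
by rewrite big_map -sumrN; apply: eq_bigr => a _; rewrite corootN.
Qed.

Lemma coroot_in_lattice a : Phi a -> coroot_lattice Phi (coroot a).
Proof.
move=> Pa; apply/coroot_latticeP; exists [:: a]; rewrite big_seq1; split=> // b.
by rewrite inE => /eqP ->.
Qed.

Lemma dot_root_coroot_lattice a x : Phi a -> coroot_lattice Phi x ->
  dot a x \is a Num.int.
Proof.
move=> Pa /coroot_latticeP [t [ht ->]]; rewrite dot_sumr big_seq.
by apply: rpred_sum => b /ht Pb; apply: (root_crystallographic Phi_root).
Qed.

Lemma dot_root_coweight a x : Phi a -> coweight_lattice Delta x ->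
  dot a x \is a Num.int.
Proof.
move=> /pos_or h zx.
suff hp b : nonneg_comb Delta b -> dot b x \is a Num.int.
  case: h => [[_ /hp] //|[_ /hp]]; by rewrite dotNl rpredN.
move=> [k ->]; rewrite dot_suml; apply: rpred_sum => i _.
by rewrite dotZl rpredM // natr_int.
Qed.

(** If one of the two Cartan integers is -1, reflecting one root in the other gives the root whose
    coroot is the sum. Otherwise both are at most -2, which makes the squared norm of [a + b]
    nonpositive, so [b = - a]. *)
Lemma coroot_sum a b : Phi a -> Phi b -> dot a b < 0 ->
  coroot a + coroot b = 0 \/ exists2 r, Phi r & coroot r = coroot a + coroot b.
Proof.
move=> Pa Pb ab.
have refl u v : Phi u -> Phi v -> dot u (coroot v) = -1 ->
    exists2 r, Phi r & coroot r = coroot u + coroot v.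
  move=> Pu Pv e; exists (reflection u v); first exact: (root_reflection Phi_root).
  have Wu := weyl_reflection Pu.
  rewrite (coroot_isometry _ (weyl_dot Wu) (weylZ Wu)) /reflection.
  have -> : dot (coroot v) (coroot u) *: u = dot u (coroot v) *: coroot u.
    by rewrite dot_corootr /coroot scalerA dotC mulrC.
  by rewrite e scaleN1r opprK addrC.
have ia := root_crystallographic Phi_root Pa Pb.
have ib := root_crystallographic Phi_root Pb Pa.
have na := dot_gt0 (root_nz Pa); have nb := dot_gt0 (root_nz Pb).
have [e|n1] := pselect (dot a (coroot b) = -1); first by right; apply: refl.
have [e|n2] := pselect (dot b (coroot a) = -1).
  by right; rewrite addrC; apply: refl.
left; suff -> : b = - a by rewrite corootN subrr.
apply/eqP; rewrite -addr_eq0 addrC; apply/eqP/dot_eq0/eqP.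
rewrite eq_le dot_ge0 andbT dotDl !dotDr (dotC b a).
have key x y : 0 < dot y y -> dot x y < 0 -> dot x (coroot y) \is a Num.int ->
    dot x (coroot y) <> -1 -> dot x y <= - dot y y.
  move=> ny xy /intrP [m em] n.
  have lt : dot x (coroot y) < 0 by rewrite dot_corootr pmulr_rlt0 // divr_gt0.
  have : dot x (coroot y) <= -2.
    move: lt n; rewrite em ltrz0 => lt n.
    rewrite -[-2]/((-2)%:~R) ler_int.
    have : m <> -1 by move=> e; apply: n; rewrite e.
    lia.
  rewrite dot_corootr mulrAC ler_pdivrMr // => h; lra.
have h1 := key a b nb ab ib n1.
have ba : dot b a < 0 by rewrite dotC.
have h2 := key b a na ba ia n2; rewrite dotC in h2; lra.
Qed.

(* In an expression of [x] as a sum of as few coroots as possible, no two have a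
   negative product, since [coroot_sum] would merge them; so a root [a] that
   occurs has [dot a x >= 2]. *)
Lemma coroot_lattice_minuscule x : coroot_lattice Phi x ->
  (forall a, Phi a -> dot a x <= 1) -> x = 0.
Proof.
move=> /coroot_latticeP [t [ht ->]].
have [n le] : exists n, (size t <= n)%N by exists (size t).
elim: n t le ht => [|n IH] [|a t] //= le ht h; try by rewrite big_nil.
have Pa : Phi a by apply: ht; rewrite inE eqxx.
have [b bt ab] : exists2 b, b \in t & dot a b < 0.
  apply/not_exists2P => nb; have := h a Pa.
  rewrite big_cons dotDr dot_self_coroot ?dot_sumr; last exact: root_nz.
  suff : 0 <= \sum_(b <- t) dot a (coroot b) by lra.
  rewrite big_seq; apply: sumr_ge0 => b bt; rewrite dot_corootr.
  have Pb : Phi b by apply: ht; rewrite inE bt orbT.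
  rewrite mulr_ge0 ?divr_ge0 ?dot_ge0 //.
  by rewrite leNgt; apply/negP => lt; case: (nb b).
have Pb : Phi b by apply: ht; rewrite inE bt orbT.
have e : \sum_(r <- a :: t) coroot r = coroot a + coroot b + \sum_(r <- rem b t) coroot r.
  by rewrite big_cons (perm_big _ (perm_to_rem bt)) big_cons addrA.
have hrem : {in rem b t, forall r, Phi r}.
  by move=> r /mem_rem rt; apply: ht; rewrite inE rt orbT.
have srem : (size (rem b t) < n)%N.
  by rewrite size_rem //; case: (t) bt le => //= *; lia.
rewrite e in h *; case: (coroot_sum Pa Pb ab) => [z|[r Pr er]].
  rewrite z add0r in h *; apply: IH => //; exact: ltnW.
have er' : coroot a + coroot b + \sum_(r <- rem b t) coroot r =
   \sum_(r <- r :: rem b t) coroot r by rewrite big_cons er.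
rewrite er' in h *; apply: IH => // r'.
by rewrite inE => /orP [/eqP ->|/hrem].
Qed.

(** An element of the group is determined by its action on the finite set of roots, which contains a
    basis. *)
Lemma weyl_finite : finite_set W.
Proof.
have Pf := root_finite Phi_root.
pose P := fset_set Phi.
pose g (f : {ffun P -> P}) : V -> V :=
  xget (id : V -> V) [set w : V -> V | W w /\ forall a : P, w (val a) = val (f a)].
apply: (@sub_finite_set _ _ (g @` setT)); last exact/finite_image/finite_finset.
move=> w Ww.
have wP (a : P) : w (val a) \in P.
  rewrite in_fset_set // inE; apply: weyl_root => //.
  by have := valP a; rewrite in_fset_set // inE.
exists [ffun a : P => [` wP a]%fset] => //.
have [Wg eg] : [set w' : V -> V | W w' /\ forall a : P, w' (val a) =
    val ([ffun a : P => [` wP a]%fset] a)] (g [ffun a : P => [` wP a]%fset]).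
  by apply: xgetPex; exists w; split=> // a; rewrite ffunE.
apply/funext => x; rewrite (rcoordE x) !weyl_sum //.
apply: eq_bigr => i _; rewrite !weylZ //; congr (_ *: _).
have Di : Delta i \in P by rewrite in_fset_set // inE; apply: simple_root.
by have := eg [` Di]%fset; rewrite ffunE.
Qed.

End RootSystem.

(** * Alcoves *)

Section Alcoves.
Variables (R : realType) (l : nat).
Local Notation V := 'rV[R]_l.
Variables (Phi : set V) (Delta : 'I_l -> V) (c : 'I_l -> nat).
Hypothesis Phi_root : root_system Phi.
Hypothesis Delta_simple : simple_roots Phi Delta.
Hypothesis c_highest : highest_root Phi Delta (root_of_coefs Delta c).
Local Notation W := (weyl_group Phi).
Local Notation pos := (positive_roots Phi Delta).
Local Notation h := (root_of_coefs Delta c).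
Local Notation eps := (ext_root Delta c).
Local Notation Q := (coroot_lattice Phi).
Local Notation Z := (coweight_lattice Delta).
Local Notation rhov := (rhov Delta_simple).
Local Notation rcoord := (rcoord Delta_simple).
Implicit Types (b g x y : V) (w : V -> V) (a : 'I_l.+1 -> nat).

Lemma ext_root0 : eps ord0 = - h.
Proof. by rewrite /ext_root unlift_none. Qed.

Lemma ext_root_lift j : eps (lift ord0 j) = Delta j.
Proof. by rewrite /ext_root liftK. Qed.

Lemma ext_coef0 : ext_coef c ord0 = 1%N.
Proof. by rewrite /ext_coef unlift_none. Qed.

Lemma ext_coef_lift j : ext_coef c (lift ord0 j) = c j.
Proof. by rewrite /ext_coef liftK. Qed.

Lemma rcoord_highest i : rcoord h i = (c i)%:R.
Proof. exact: (rcoord_comb Delta_simple (fun i => (c i)%:R)). Qed.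

Lemma rcoord_le_highest b i : Phi b -> rcoord b i <= (c i)%:R.
Proof.
move=> Pb; rewrite -rcoord_highest -subr_ge0 -[_ - _](dotBl).
by apply: rcoord_ge0; case: c_highest => _; apply.
Qed.

Lemma coef_gt0 i : (0 < c i)%N.
Proof.
have := rcoord_le_highest i (simple_root Delta_simple i).
by rewrite rcoord_Delta eqxx ler1n.
Qed.

Lemma ext_coef_gt0 i : (0 < ext_coef c i)%N.
Proof. by rewrite /ext_coef; case: unliftP => // j _; apply: coef_gt0. Qed.

Lemma ext_root_sum : \sum_i (ext_coef c i)%:R *: eps i = 0.
Proof.
rewrite big_ord_recl ext_coef0 ext_root0 scale1r addrC; apply/eqP; rewrite subr_eq0.
by apply/eqP/eq_bigr => i _; rewrite ext_coef_lift ext_root_lift.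
Qed.

Lemma ext_root_root i : Phi (eps i).
Proof.
rewrite /ext_root; case: unliftP => [j|] _; first exact: simple_root Delta_simple j.
by apply: (root_opp Phi_root); case: c_highest.
Qed.

(** A positive root uses its simple coordinates and 0 at [ord0]; a negative one is the opposite of
    the highest root plus a nonnegative combination. The upper bound makes the complementary
    coefficients usable as well. *)
Lemma ext_comb b : Phi b ->
  exists2 G : 'I_l.+1 -> nat, (forall i, (G i <= ext_coef c i)%N) &
    b = \sum_i (G i)%:R *: eps i.
Proof.
move=> Pb; have [[_ [k ek]]|[Pn [k ek]]] := pos_or Phi_root Delta_simple Pb.
  exists (fun i => if unlift ord0 i is Some j then k j else 0%N).
    move=> i; case: unliftP => // j ->; rewrite ext_coef_lift -(ler_nat R).
    rewrite -(rcoord_comb Delta_simple (fun j => (k j)%:R)) -ek.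
    exact: rcoord_le_highest.
  rewrite big_ord_recl unlift_none scale0r add0r ek.
  by apply: eq_bigr => j _; rewrite liftK ext_root_lift.
have le j : (k j <= c j)%N.
  rewrite -(ler_nat R) -(rcoord_comb Delta_simple (fun j => (k j)%:R)) -ek.
  exact: rcoord_le_highest.
exists (fun i => if unlift ord0 i is Some j then (c j - k j)%N else 1%N).
  move=> i; case: unliftP => [j|] ->; last by rewrite ext_coef0.
  by rewrite ext_coef_lift leq_subr.
rewrite big_ord_recl unlift_none scale1r ext_root0.
rewrite -[LHS]opprK ek /root_of_coefs -!sumrN -big_split /=.
apply: eq_bigr => j _; rewrite liftK ext_root_lift natrB // scalerBl.
by rewrite addrA addNr add0r.
Qed.

Lemma ht_gt0 b : pos b -> 0 < dot b rhov.
Proof.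
move=> [Pb nb]; have ge i := rcoord_ge0 Delta_simple i nb.
rewrite lt_neqAle dot_rhov sumr_ge0 // andbT eq_sym; apply/eqP => /eqP.
rewrite psumr_eq0 // => /allP e; apply: (root_nz Phi_root Pb).
rewrite (rcoordE Delta_simple b) big1 // => i _.
by have /eqP -> := e i (mem_index_enum i); rewrite scale0r.
Qed.

(** The Coxeter number, which exceeds the height of every root. *)
Definition ht_bound : nat := (\sum_i c i).+1.
Local Notation N := ht_bound.

Lemma ht_lt b : Phi b -> dot b rhov < N%:R.
Proof.
move=> Pb; rewrite dot_rhov /ht_bound -natr1 natr_sum ltr_pwDr //.
by apply: ler_sum => i _; apply: rcoord_le_highest.
Qed.

Lemma ht_gt b : Phi b -> - N%:R < dot b rhov.
Proof. by move=> /(root_opp Phi_root)/ht_lt; rewrite dotNl ltrNl. Qed.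

Lemma ht_notin_pos b : Phi b -> b \notin pos -> dot b rhov < 0.
Proof.
move=> Pb; rewrite notin_setE => nb.
by have [//|/ht_gt0] := pos_or Phi_root Delta_simple Pb; rewrite dotNl oppr_gt0.
Qed.

(* [m * [w (eps i) > 0]] moves the walls of the alcove into the strip that the
   Linial arrangement leaves free. *)
Definition in_alcove (w : V -> V) (m q : nat) (a : 'I_l.+1 -> nat) (x : V) : Prop :=
  forall i, dot (w (eps i)) x =
    (a i + m * (w (eps i) \in pos))%:R - (q * (i == ord0))%:R.

(** Pair [x] with the image under [w] of the linear relation [ext_root_sum]; the offset [q] enters
    once because [ext_coef c ord0] is 1. *)
Lemma in_alcove_sum w m q a x : W w -> in_alcove w m q a x ->
  (\sum_i ext_coef c i * a i + m * asc Phi Delta c w)%N = q.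
Proof.
move=> Ww hx; apply/eqP; rewrite -(eqr_nat R) -subr_eq0; apply/eqP.
have : dot (w (\sum_i (ext_coef c i)%:R *: eps i)) x = 0.
  rewrite ext_root_sum -(scale0r (0 : V)) (weylZ Phi_root Ww) scale0r dot0l //.
rewrite (weyl_sum Phi_root Ww) dot_suml => <-.
rewrite (eq_bigr (fun i => (ext_coef c i * a i)%:R +
    (m * (if w (eps i) \in pos then ext_coef c i else 0))%:R - (q * (i == ord0))%:R)).
  rewrite !big_split /= -!natr_sum -natrD -big_distrr /= -big_mkcond /=.
  rewrite sumrN -natr_sum -big_distrr /=.
  have -> : (\sum_(i < l.+1) (i == ord0))%N = 1%N.
    by rewrite (bigD1 ord0) //= big1 // => i /negPf ->.
  by rewrite muln1.
move=> i _; rewrite (weylZ Phi_root Ww) dotZl hx mulrBr -!natrM mulnDr natrD.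
congr (_ + _%:R - _).
  by case: ifP => _; rewrite ?muln1 ?muln0 // mulnC.
have [->|] := eqVneq i ord0; last by rewrite !muln0.
by rewrite ext_coef0 mul1n.
Qed.

(** The same relation, solved for the missing equation at [ord0]. *)
Lemma in_alcove_of_simple w m q a x : W w ->
    (\sum_i ext_coef c i * a i + m * asc Phi Delta c w)%N = q ->
    (forall j, dot (w (Delta j)) x =
       (a (lift ord0 j) + m * (w (Delta j) \in pos))%:R) ->
  in_alcove w m q a x.
Proof.
move=> Ww hs hx i; case: (unliftP ord0 i) => [j|] ->.
  by rewrite ext_root_lift hx muln0 subr0.
have easc : asc Phi Delta c w = ((if w (eps ord0) \in pos then 1 else 0) +
    \sum_(j < l) if w (eps (lift ord0 j)) \in pos then ext_coef c (lift ord0 j) else 0)%N.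
  by rewrite /asc big_mkcond big_ord_recl ext_coef0.
rewrite eqxx muln1 -hs easc big_ord_recl ext_coef0 mul1n.
rewrite {1}ext_root0 (weylN Phi_root Ww) dotNl (weyl_sum Phi_root Ww) dot_suml.
rewrite (eq_bigr (fun i => (ext_coef c (lift ord0 i) * a (lift ord0 i))%:R +
  (m * (if w (eps (lift ord0 i)) \in pos then ext_coef c (lift ord0 i) else 0))%:R)).
  rewrite big_split /= -!natr_sum -!big_distrr /= mulnDr !natrD.
  have -> : (m * (if w (eps ord0) \in pos then 1 else 0) = m * (w (eps ord0) \in pos))%N.
    by case: ifP.
  ring.
move=> j _; rewrite (weylZ Phi_root Ww) dotZl hx -natrM -natrD ext_coef_lift.
rewrite ext_root_lift mulnDr; congr (_ + _)%:R.
by case: ifP => _; rewrite ?muln1 ?muln0 // mulnC.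
Qed.

Lemma in_alcove_coweight w m q a x : W w -> in_alcove w m q a x -> Z x.
Proof.
move=> Ww hx i; have [v Wv [K K']] := weyl_inv Phi_root Ww.
have Pv := weyl_root Phi_root Wv (simple_root Delta_simple i).
have [G _ eG] := ext_comb Pv.
rewrite -(K' (Delta i)) eG (weyl_sum Phi_root Ww) dot_suml.
apply: rpred_sum => j _; rewrite (weylZ Phi_root Ww) dotZl hx.
by rewrite rpredM ?rpredB ?natr_int.
Qed.

(** Expand [b] on the walls [w (eps i)] with the coefficients [G] of [ext_comb]. Only the wall
    [ord0] carries the offset [q], whence [k = - G ord0]. *)
Lemma in_alcove_strip w m q a x b : W w -> in_alcove w m q a x -> pos b ->
  exists k : int, m%:R + q%:R * k%:~R <= dot b x <= q%:R * k%:~R + q%:R.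
Proof.
move=> Ww hx pb; have [Pb _] := pb; have [v Wv [K K']] := weyl_inv Phi_root Ww.
have [G leG eG] := ext_comb (weyl_root Phi_root Wv Pb).
have eb y : dot b y = \sum_i (G i)%:R * dot (w (eps i)) y.
  rewrite -(K' b) eG (weyl_sum Phi_root Ww) dot_suml.
  by apply: eq_bigr => i _; rewrite (weylZ Phi_root Ww) dotZl.
have split_q (F : 'I_l.+1 -> R) : \sum_i F i * dot (w (eps i)) x =
    \sum_i F i * (a i + m * (w (eps i) \in pos))%:R - q%:R * F ord0.
  under eq_bigr => i _ do rewrite hx mulrBr.
  rewrite sumrB; congr (_ - _); rewrite (bigD1 ord0) //= big1 ?addr0.
    by rewrite muln1 mulrC.
  by move=> i /negPf ->; rewrite muln0 mulr0.
exists (- (G ord0)%:Z); rewrite rmorphN /= -pmulrn; apply/andP; split.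
  rewrite eb split_q mulrN lerD2r.
  (* As [b] has positive height, some wall in its expansion is a positive root, and that one
     contributes at least [m]. *)
  have [i G0 pi] : exists2 i, (0 < G i)%N & w (eps i) \in pos.
    apply/not_exists2P => hn; have := ht_gt0 pb; rewrite eb ltNge; case/negP.
    apply: sumr_le0 => i _; case: (posnP (G i)) => [->|G0]; first by rewrite mul0r.
    rewrite mulr_ge0_le0 // ltW // ht_notin_pos //.
      apply: (weyl_root Phi_root Ww); exact: ext_root_root.
    by apply/negP => pi; case: (hn i).
  rewrite (bigD1 i) //= -natrM pi muln1; apply: ler_wpDr.
    by apply: sumr_ge0 => j _; rewrite -natrM.
  by rewrite ler_nat; nia.
(* For the upper bound, [- b] is expanded with the complementary coefficients
   [ext_coef c i - G i]. *)
have e0 : \sum_i (ext_coef c i)%:R * dot (w (eps i)) x = 0.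
  have e : dot (w 0) x = 0 by rewrite -(scale0r (0 : V)) (weylZ Phi_root Ww) scale0r dot0l.
  rewrite -[RHS]e -ext_root_sum (weyl_sum Phi_root Ww) dot_suml.
  by apply: eq_bigr => i _; rewrite (weylZ Phi_root Ww) dotZl.
have -> : dot b x = - \sum_i (ext_coef c i - G i)%:R * dot (w (eps i)) x.
  rewrite eb -[LHS]subr0 -[X in _ - X]e0 -sumrB -sumrN; apply: eq_bigr => i _.
  by rewrite natrB ?leG // -mulrBl -mulNr opprB.
rewrite split_q natrB ?leG // ext_coef0 opprB mulrBr mulr1 mulrN.
rewrite [X in _ <= X]addrC gerBl.
by apply: sumr_ge0 => i _; rewrite -natrM.
Qed.

Lemma in_alcove_avoids w m q a x b k : (0 < q)%N -> W w ->
    in_alcove w m q a x -> pos b -> (1 <= k < m)%N ->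
  ~ congruent_mod q (dot b x) k%:R.
Proof.
move=> q0 Ww hx pb /andP [k1 km] [z e].
have [j /andP [lo up]] := in_alcove_strip Ww hx pb.
have {e}e : dot b x = k%:R + z%:~R * q%:R by rewrite -e addrC subrK.
have q1 : 1 <= q%:R :> R by rewrite ler1n.
have k1' : 1 <= k%:R :> R by rewrite ler1n.
have km' : k%:R + 1 <= m%:R :> R by rewrite natr1 ler_nat.
have lt1 : j < z by rewrite -(ltr_int R) -(ltr_pM2r (lt_le_trans ltr01 q1)); lra.
have lt2 : z < j + 1.
  by rewrite -(ltr_int R) -(ltr_pM2r (lt_le_trans ltr01 q1)) intrD; lra.
lia.
Qed.

Lemma sum_root_sqr_reflection (a : V) y z : Phi a ->
  \sum_(g <- fset_set Phi) dot g (reflection a y) * dot g (reflection a z) =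
  \sum_(g <- fset_set Phi) dot g y * dot g z.
Proof.
move=> Pa; have nz := root_nz Phi_root Pa; have Pf := root_finite Phi_root.
have inj : injective (reflection a) by apply: can_inj (reflectionK nz).
have pe : perm_eq (map (reflection a) (fset_set Phi)) (fset_set Phi).
  apply: uniq_perm; [by rewrite map_inj_uniq ?fset_uniq|exact: fset_uniq|] => g.
  apply/mapP/idP => [[b bP ->]|].
    move: bP; rewrite !in_fset_set // !inE; exact: root_reflection Phi_root _ _ Pa.
  rewrite in_fset_set // inE => Pg; exists (reflection a g).
    by rewrite in_fset_set // inE; apply: root_reflection Phi_root _ _ Pa Pg.
  by rewrite reflectionK.
rewrite -[in LHS](perm_big _ pe) big_map; apply: eq_bigr => g _.
by rewrite !(dot_reflection nz).
Qed.

(* Minimise the W-invariant form [sum_g (g, y)^2], which takes natural values on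
   coweights, over a coset of [K Q]. *)
Lemma coroot_translate_small x (K : nat) : (0 < K)%N -> Z x ->
  exists2 mu, Q mu & forall a : V, Phi a -> dot a (x - K%:R *: mu) <= K%:R.
Proof.
move=> K0 Zx; have Pf := root_finite Phi_root.
pose B y z : R := \sum_(g <- fset_set Phi) dot g y * dot g z.
have BC y z : B y z = B z y by apply: eq_bigr => g _; rewrite mulrC.
have BD y y' z : B (y + y') z = B y z + B y' z.
  by rewrite -big_split /=; apply: eq_bigr => g _; rewrite dotDr mulrDl.
have BZ k y z : B (k *: y) z = k * B y z.
  by rewrite mulr_sumr; apply: eq_bigr => g _; rewrite dotZr mulrA.
have Bnat mu : Q mu -> B (x - K%:R *: mu) (x - K%:R *: mu) \is a Num.nat.
  move=> Qmu; rewrite /B big_seq; apply: rpred_sum => g.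
  rewrite in_fset_set // inE => Pg; rewrite -expr2 natr_exp_even //.
  rewrite dotBr dotZr rpredB ?rpredM ?natr_int //.
    exact: (dot_root_coweight Phi_root Delta_simple).
  exact: (dot_root_coroot_lattice Phi_root).
have ex : exists n : nat, `[< exists2 mu, Q mu &
    B (x - K%:R *: mu) (x - K%:R *: mu) = n%:R >].
  have /natrP [n en] := Bnat 0 (coroot_lattice0 Phi_root).
  by exists n; apply/asboolP; exists 0 => //; apply: coroot_lattice0 Phi_root.
case: (ex_minnP ex) => n /asboolP [mu Qmu en] min; exists mu => // a Pa.
have Qa := coroot_in_lattice Phi_root Pa.
have Qmu' := coroot_latticeD Phi_root Qmu Qa.
have /natrP [n' en'] := Bnat _ Qmu'.
have le : (n <= n')%N by apply: min; apply/asboolP; exists (mu + coroot a).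
move: le; rewrite -(ler_nat R) -en -en'.
set y := x - _.
have -> : x - K%:R *: (mu + coroot a) = y + (- K%:R) *: coroot a.
  by rewrite scalerDr opprD addrA scaleNr.
rewrite BD BZ BC BD BZ [B (coroot a) (_ + _)]BC BD BZ.
have nz := root_nz Phi_root Pa; have n0 := dot_gt0 nz.
have Ba : 0 < B a a.
  rewrite /B (big_fsetD1 a) /=; last by rewrite in_fset_set // inE.
  apply: ltr_pwDl; first by rewrite mulr_gt0.
  by apply: sumr_ge0 => g _; rewrite -expr2 sqr_ge0.
(* Invariance of [B] under the reflection in [a] makes the [B]-projection on [a] agree with the
   Euclidean one. *)
have key : 2 * B y a = 2 / dot a a * dot y a * B a a.
  have : B (reflection a y) (reflection a a) = B y a.
    exact: sum_root_sqr_reflection.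
  rewrite reflection_self // -scaleN1r [B _ (-1 *: _)]BC BZ [B a _]BC.
  rewrite /reflection BD -scaleNr BZ dot_corootr => e.
  rewrite mulr_natl mulr2n -{1}e; ring.
rewrite /coroot !BZ [B y (_ *: _)]BC BZ [B a (_ *: _)]BC BZ [B a y]BC.
rewrite dotC; set t := dot a a in n0 key *; set d := dot y a in key *.
set b := B y y; set e := B a a in Ba key *; set s := B y a in key *.
have n2 : 2 != 0 :> R by rewrite pnatr_eq0.
have -> : s = d * e / t by apply: (mulfI n2); rewrite key; ring.
move=> hle.
have K0' : 0 < K%:R :> R by rewrite ltr0n.
(* This is the change of the form from [mu] to [mu + coroot a], nonnegative by minimality; the first
   factor is positive, so [d <= K]. *)
have : 0 <= (4 * K%:R * e / t ^+ 2) * (K%:R - d).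
  have -> : (4 * K%:R * e / t ^+ 2) * (K%:R - d) =
    b + - K%:R * (2 / t * (d * e / t)) +
      - K%:R * (2 / t * (d * e / t) + - K%:R * (2 / t * (2 / t * e))) - b.
    by field; rewrite gt_eqF.
  rewrite subr_ge0; apply: (le_trans hle); rewrite le_eqVlt; apply/orP; left.
  by apply/eqP; ring.
rewrite pmulr_rge0 ?subr_ge0 //.
by rewrite divr_gt0 ?mulr_gt0 ?exprn_gt0.
Qed.

(** Choose [w] maximising the product of [w rhov] with [y]: replacing [w] by
    [w \o reflection (Delta i)] changes it by a negative multiple of [dot (w (Delta i)) y]. *)
Lemma weyl_dominant y : exists2 w, W w & forall i, 0 <= dot (w (Delta i)) y.
Proof.
have Wf := weyl_finite Phi_root Delta_simple.
have Wid : (id : V -> V) \in fset_set W by rewrite in_fset_set // inE; apply: weyl_id.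
pose F (w : fset_set W) : R := dot (val w rhov) y.
have [w _ max] := arg_maxP F (erefl true : xpredT [` Wid]%fset).
have Ww : W (val w) by have := valP w; rewrite in_fset_set // inE.
exists (val w) => // i.
have Pi := simple_root Delta_simple i.
have Ww' : W (val w \o reflection (Delta i)).
  by apply: weyl_comp => //; apply: weyl_reflection.
have w'W : (val w \o reflection (Delta i)) \in fset_set W by rewrite in_fset_set // inE.
have := max [` w'W]%fset isT; rewrite /F /= /reflection (weylD Phi_root Ww).
rewrite (weylN Phi_root Ww) (weylZ Phi_root Ww) dotBl dotZl gerBl.
rewrite dot_corootr [dot rhov _]dotC dot_coweight mulr1 pmulr_rge0 // divr_gt0 //.
exact: dot_gt0 (root_nz Phi_root Pi).
Qed.

(* [N x - rhov] is a perturbation of [x], scaled to stay a coweight: it is on no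
   wall because [0 < |dot b rhov| < N] for every root [b]. *)
Lemma alcove_exists m q x : (0 < m)%N -> (0 < q)%N -> Z x ->
    (forall b k, pos b -> (1 <= k < m)%N -> ~ congruent_mod q (dot b x) k%:R) ->
  exists w mu a, [/\ W w, Q mu & in_alcove w m q a (x - q%:R *: mu)].
Proof.
move=> m0 q0 Zx hx; pose z := N%:R *: x - rhov.
have Zz : Z z.
  move=> i; by rewrite /z dotBr dotZr dot_coweight rpredB ?rpredM ?natr_int ?rpred1.
have K0 : (0 < N * q)%N by rewrite muln_gt0 q0.
have [mu Qmu hmu] := coroot_translate_small K0 Zz.
have [w Ww hw] := weyl_dominant (z - (N * q)%:R *: mu).
have N0 : 0 < N%:R :> R by rewrite ltr0n.
exists w, mu.
suff ex i : exists k : nat, dot (w (eps i)) (x - q%:R *: mu) =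
    (k + m * (w (eps i) \in pos))%:R - (q * (i == ord0))%:R.
  by have [a ha] := boolp.choice ex; exists a.
set b := w (eps i).
have Pb : Phi b by apply: (weyl_root Phi_root Ww); apply: ext_root_root.
have intd : dot b x \is a Num.int by exact: (dot_root_coweight Phi_root Delta_simple).
have intmu : dot b mu \is a Num.int by exact: (dot_root_coroot_lattice Phi_root).
pose e := dot b (x - q%:R *: mu) + (q * (i == ord0))%:R.
have ee : e = dot b x - q%:R * dot b mu + q%:R * (i == ord0)%:R.
  by rewrite /e dotBr dotZr natrM.
have inte : e \is a Num.int by rewrite ee !(rpredD, rpredB, rpredM, rpredN) ?natr_int.
(* The integer [e] is the distance to the wall. Heights exceed [- N], so [e >= 0]; if [b] is
   positive then [e > 0], and the avoided residues push it up to [e >= m]. *)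
have he : dot b rhov <= N%:R * e.
  have : - (N * q)%:R * (i == ord0)%:R <= dot b (z - (N * q)%:R *: mu).
    rewrite /b; case: (unliftP ord0 i) => [j|] ->.
      by rewrite mulr0 ext_root_lift; apply: hw.
    rewrite mulr1 ext_root0 (weylN Phi_root Ww) dotNl lerN2; apply: hmu.
    by apply: (weyl_root Phi_root Ww); case: c_highest.
  rewrite ee /z !(dotBr, dotZr) natrM; nra.
have [k ek] : exists k : nat, e = (k + m * (b \in pos))%:R.
  have /intrP [d ed] := inte.
  have [pb|nb] := boolP (b \in pos); last first.
    have h1 := ht_gt Pb.
    have : -1 < e by rewrite -(ltr_pM2l N0); lra.
    rewrite ed -[-1]/((-1)%:~R) ltr_int => hd; exists (absz d).
    rewrite muln0 addn0 pmulrn; congr _%:~R; lia.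
  have pb' : pos b by rewrite inE in pb.
  have : 0 < e by rewrite -(pmulr_rgt0 _ N0); have := ht_gt0 pb'; lra.
  rewrite ed ltr0z => hd.
  have [le|lt] := leqP m (absz d).
    exists (absz d - m)%N; rewrite muln1 subnK // pmulrn; congr _%:~R; lia.
  case: (hx b (absz d) pb'); first by lia.
  have /intrP [d' ed'] := intmu.
  exists (d' - (i == ord0)%:Z).
  have -> : (absz d)%:R = e by rewrite ed pmulrn; congr _%:~R; lia.
  rewrite ee ed' intrD rmorphN /= -pmulrn; ring.
by exists k; rewrite -ek /e addrK.
Qed.

(** A wall that contains [x] is a negative root, so subtracting [rhov] moves inwards from it; a
    positive wall is at distance at least [m], and [N * m] exceeds its height. *)
Lemma in_alcove_interior w m q a x b : (0 < m)%N -> W w ->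
    in_alcove w m q a x -> pos b ->
  0 < dot (w b) (N%:R *: x - rhov) < (N * q)%:R.
Proof.
move=> m0 Ww hx pb; have [Pb nb] := pb; set y := _ - _.
have N0 : 0 < N%:R :> R by rewrite ltr0n.
have wall i : 0 < dot (w (eps i)) y + (N * q * (i == ord0))%:R.
  have Pe := weyl_root Phi_root Ww (ext_root_root i).
  rewrite /y dotBr dotZr hx -mulnA [X in _ + X]natrM mulrBr addrAC subrK.
  rewrite subr_gt0; have [pe|ne] := boolP (_ \in pos); last first.
    by apply: lt_le_trans (ht_notin_pos Pe ne) _; rewrite -natrM.
  apply: lt_le_trans (ht_lt Pe) _; rewrite -natrM ler_nat; nia.
have wallD i : 0 < dot (w (Delta i)) y.
  by have := wall (lift ord0 i); rewrite muln0 addr0 ext_root_lift.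
have comb b' : dot (w b') y = \sum_i rcoord b' i * dot (w (Delta i)) y.
  rewrite {1}(rcoordE Delta_simple b') (weyl_sum Phi_root Ww) dot_suml.
  by apply: eq_bigr => i _; rewrite (weylZ Phi_root Ww) dotZl.
apply/andP; split.
  rewrite lt_neqAle comb sumr_ge0 ?andbT => [|i _]; last first.
    by rewrite mulr_ge0 ?rcoord_ge0 // ltW.
  rewrite eq_sym; apply/eqP => /eqP; rewrite psumr_eq0 => [/allP e|i _]; last first.
    by rewrite mulr_ge0 ?rcoord_ge0 // ltW.
  apply: (root_nz Phi_root Pb).
  rewrite (rcoordE Delta_simple b) big1 // => i _.
  have := e i (mem_index_enum i); rewrite mulf_eq0 (gt_eqF (wallD i)) orbF.
  by move=> /eqP ->; rewrite scale0r.
have := wall ord0; rewrite ext_root0 (weylN Phi_root Ww) dotNl muln1.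
rewrite addrC subr_gt0; apply: le_lt_trans.
rewrite !comb; apply: ler_sum => i _; rewrite ler_wpM2r ?(ltW (wallD i)) //.
by rewrite rcoord_highest; apply: rcoord_le_highest.
Qed.

(* Two alcoves containing [x] have translations whose difference pairs to at most
   [1] with every root, hence is zero by [coroot_lattice_minuscule]. *)
Lemma alcove_unique m q x w mu a w' mu' a' : (0 < m)%N -> (0 < q)%N ->
    W w -> Q mu -> in_alcove w m q a (x - q%:R *: mu) ->
    W w' -> Q mu' -> in_alcove w' m q a' (x - q%:R *: mu') ->
  [/\ w = w', mu = mu' & a = a'].
Proof.
move=> m0 q0 Ww Qmu hx Ww' Qmu' hx'.
have [v Wv [K K']] := weyl_inv Phi_root Ww.
have [v' Wv' [L L']] := weyl_inv Phi_root Ww'.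
set y := x - q%:R *: mu in hx; set y' := x - q%:R *: mu' in hx'.
have Nq0 : 0 < (N * q)%:R :> R by rewrite ltr0n muln_gt0 q0.
have Qd := coroot_latticeD Phi_root Qmu (coroot_latticeN Phi_root Qmu').
have ey b : dot b (N%:R *: y' - rhov) =
    dot b (N%:R *: y - rhov) + (N * q)%:R * dot b (mu - mu').
  rewrite /y /y' natrM !(dotBr, dotZr); ring.
(* The two perturbed points differ by [N * q] times [mu - mu'], and each root takes on each of them
   a value strictly between 0 and [N * q] up to sign. Equal signs leave only the integer 0, opposite
   signs only 1. *)
have key b : pos b ->
    dot (w' b) (mu - mu') = (if v (w' b) \in pos then 0 else 1).
  move=> pb; have [Pb _] := pb.
  have Pw := weyl_root Phi_root Ww' Pb; have Pvw := weyl_root Phi_root Wv Pw.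
  have /andP [] := in_alcove_interior m0 Ww' hx' pb.
  have /intrP [d ed] := dot_root_coroot_lattice Phi_root Pw Qd.
  rewrite ey -{1 3}(K' (w' b)) ed.
  have [pv|nv] := boolP (v (w' b) \in pos).
    have /andP [h1 h2] := in_alcove_interior m0 Ww hx (set_mem pv).
    move=> h3 h4.
    have d1 : (-1)%:~R < d%:~R :> R by rewrite -(ltr_pM2l Nq0) rmorphN1; lra.
    have d2 : d%:~R < 1%:~R :> R by rewrite -(ltr_pM2l Nq0); lra.
    move: d1 d2; rewrite !ltr_int => d1 d2.
    by have -> : d = 0 by lia.
  have [|pn] := pos_or Phi_root Delta_simple Pvw; first by move=> /mem_set; rewrite (negPf nv).
  have /andP [] := in_alcove_interior m0 Ww hx pn.
  rewrite (weylN Phi_root Ww) dotNl => h1 h2 h3 h4.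
  have d1 : 0%:~R < d%:~R :> R by rewrite -(ltr_pM2l Nq0); lra.
  have d2 : d%:~R < 2%:~R :> R by rewrite -(ltr_pM2l Nq0); lra.
  move: d1 d2; rewrite !ltr_int => d1 d2.
  by have -> : d = 1 by lia.
have mu0 : mu - mu' = 0.
  apply: (coroot_lattice_minuscule Phi_root Qd) => b Pb; rewrite -(L' b).
  have Pv := weyl_root Phi_root Wv' Pb.
  have [/key ->|/key] := pos_or Phi_root Delta_simple Pv; first by case: ifP => _.
  rewrite (weylN Phi_root Ww') dotNl; case: ifP => _ e; lra.
have emu : mu = mu' by apply/eqP; rewrite -subr_eq0 mu0.
(* With equal translations the value 1 is excluded, so [v \o w'] sends every simple root to a
   positive root. *)
have ew : v \o w' = id.
  apply: (weyl_pos_id Phi_root Delta_simple (weyl_comp Wv Ww')) => i.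
  have := key _ (pos_Delta Delta_simple i); rewrite mu0 dot0r /=.
  case: ifP => [/set_mem //|_ /eqP]; by rewrite eq_sym oner_eq0.
have eww : w = w'.
  by apply/funext => u; rewrite -[RHS]K' -[v (w' u)]/((v \o w') u) ew.
split=> //; apply/funext => i; apply/eqP; rewrite -(eqr_nat R); apply/eqP.
have := hx i; have := hx' i; rewrite /y' -emu -/y -eww => -> /eqP.
by rewrite (inj_eq (addIr _)) eqr_nat eqn_add2r => /eqP ->.
Qed.

End Alcoves.

(** * Counting points off the Linial arrangement *)

Section FiniteImages.

Lemma card_fset_set_image (T : finType) (U : choiceType) (P : pred T) (F : T -> U) :
  {in P &, injective F} -> #|` fset_set (F @` [set x | P x]) | = #|P|.
Proof.
have fP : finite_set [set x | P x] by apply: finite_finset.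
move=> inj; rewrite fset_set_image //.
have -> : fset_set [set x | P x] = [fset x in P]%fset.
  by apply/fsetP => x; rewrite in_fset_set //; apply/asboolP/idP; rewrite inE.
rewrite card_in_imfset ?card_finset // => x y.
by rewrite !inE; apply: inj.
Qed.

Lemma card_fset_setM (T U : choiceType) (A : set T) (B : set U) :
  finite_set A -> finite_set B ->
  #|` fset_set (A `*` B)| = (#|` fset_set A| * #|` fset_set B|)%N.
Proof.
move=> fA fB; rewrite [X in (X * _)%N]cardfE [X in (_ * X)%N]cardfE -card_prod.
rewrite -(@card_fset_set_image _ _ xpredT
  (fun p : fset_set A * fset_set B => (val p.1, val p.2))); last first.
  by move=> [x y] [x' y'] _ _ [/val_inj -> /val_inj ->].
congr #|` fset_set _|; apply/seteqP; split=> [[x y] [/= Ax By]|_ [[x y] _ <-]] /=.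
  have xA : x \in fset_set A by rewrite in_fset_set // inE.
  have yB : y \in fset_set B by rewrite in_fset_set // inE.
  by exists ([` xA]%fset, [` yB]%fset).
by split; [have := valP x|have := valP y]; rewrite in_fset_set // inE.
Qed.

(** Finiteness of the two collections of cosets is obtained from their product, the image of a
    finite type of labels. *)
Lemma finite_setM_proj (T U : Type) (A : set T) (B : set U) :
  finite_set (A `*` B) -> A !=set0 -> B !=set0 -> finite_set A /\ finite_set B.
Proof.
move=> f [a Aa] [b Bb]; split.
- rewrite (_ : A = fst @` (A `*` B)); first exact: finite_image.
  apply/seteqP; split=> [x Ax|_ [[x y] [/= Ax _] <-]] //; by exists (x, b).
- rewrite (_ : B = snd @` (A `*` B)); first exact: finite_image.
  apply/seteqP; split=> [y By|_ [[x y] [/= _ By] <-]] //; by exists (a, y).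
Qed.

End FiniteImages.

Section Counting.
Variables (R : realType) (l : nat).
Local Notation V := 'rV[R]_l.
Variables (Phi : set V) (Delta : 'I_l -> V) (c : 'I_l -> nat).
Hypothesis Phi_root : root_system Phi.
Hypothesis Delta_simple : simple_roots Phi Delta.
Hypothesis c_highest : highest_root Phi Delta (root_of_coefs Delta c).
Local Notation W := (weyl_group Phi).
Local Notation pos := (positive_roots Phi Delta).
Local Notation Q := (coroot_lattice Phi).
Local Notation Z := (coweight_lattice Delta).
Local Notation coweight := (coweight Delta_simple).
Local Notation eps := (ext_root Delta c).

Lemma coset_eqP (B : set V) x y : B 0 ->
    (forall u v, B u -> B v -> B (u + v)) -> (forall u, B u -> B (- u)) ->
  coset B x = coset B y <-> B (x - y).
Proof.
move=> B0 BD BN; split=> [e|b].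
  suff : coset B y x by [].
  by rewrite -e /coset /mkset subrr.
apply/seteqP; split=> z; rewrite /coset /mkset => bz.
- have -> : z - y = (z - x) + (x - y) by rewrite addrA subrK.
  exact: BD.
- have -> : z - x = (z - y) + - (x - y) by rewrite opprB addrA subrK.
  by apply: BD => //; apply: BN.
Qed.

Lemma coweight_lattice0 : Z 0.
Proof. by move=> i; rewrite dot0r rpred0. Qed.

Lemma coweight_latticeD x y : Z x -> Z y -> Z (x + y).
Proof. by move=> zx zy i; rewrite dotDr rpredD. Qed.

Lemma coweight_latticeN x : Z x -> Z (- x).
Proof. by move=> zx i; rewrite dotNr rpredN. Qed.

Lemma coroot_lattice_coweight x : Q x -> Z x.
Proof.
by move=> Qx i; apply: dot_root_coroot_lattice Phi_root _ _ (simple_root Delta_simple i) Qx.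
Qed.

Lemma coset_coroot_lattice x y : coset Q x = coset Q y <-> Q (x - y).
Proof.
apply: coset_eqP; [exact: coroot_lattice0 Phi_root|exact: coroot_latticeD Phi_root|].
exact: coroot_latticeN Phi_root.
Qed.

Lemma coset_dilate_coweight q x y :
  coset (dilate q%:R Z) x = coset (dilate q%:R Z) y <->
  exists2 z, Z z & x = y + q%:R *: z.
Proof.
rewrite coset_eqP.
- split=> [[z Zz e]|[z Zz ->]]; exists z => //; first by rewrite e addrC subrK.
  by rewrite addrAC subrr add0r.
- by exists 0; rewrite ?scaler0 //; apply: coweight_lattice0.
- move=> _ _ [u Zu <-] [v Zv <-]; exists (u + v); rewrite ?scalerDr //.
  exact: coweight_latticeD.
- by move=> _ [u Zu <-]; exists (- u); rewrite ?scalerN //; apply: coweight_latticeN.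
Qed.

Section Modulus.
Variables (n q : nat).
Hypothesis q_gt0 : (0 < q)%N.
Local Notation m := n.+1.

Definition linial_complement : set V :=
  [set x | Z x /\ forall H, linial Phi Delta n H -> ~ congruent_mod q (dot H.1 x) H.2%:R].

Local Notation U := (fset_set W).
Local Notation A := {ffun 'I_l.+1 -> 'I_q.+1}.

Definition labels : pred (U * A) := fun p =>
  (\sum_i ext_coef c i * p.2 i + m * asc Phi Delta c (val p.1) == q)%N.

Definition alcove_point (p : U * A) : V :=
  val p.1 (coweight (fun j => (p.2 (lift ord0 j) + m * (val p.1 (Delta j) \in pos))%:R)).

Lemma weyl_val (w : U) : W (val w).
Proof.
by have := valP w; rewrite in_fset_set ?inE //; apply: weyl_finite Phi_root Delta_simple.
Qed.

Lemma alcove_pointP p : labels p ->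
  in_alcove Phi Delta c (val p.1) m q (fun i => p.2 i) (alcove_point p).
Proof.
move=> /eqP hp; have Ww := weyl_val p.1.
apply: (in_alcove_of_simple Phi_root Ww hp) => j.
by rewrite (weyl_dot Phi_root Ww) dot_coweight.
Qed.

Lemma alcove_point_complement p : labels p -> linial_complement (alcove_point p).
Proof.
move=> hp; have Ww := weyl_val p.1; have h := alcove_pointP hp; split.
  exact: (in_alcove_coweight Phi_root Delta_simple c_highest Ww h).
move=> [b k] [/= pb kn].
by apply: (in_alcove_avoids Phi_root Delta_simple c_highest q_gt0 Ww h pb); lia.
Qed.

Local Notation qZ := (dilate q%:R Z).

Definition rep (C : set V) : V := xget 0 C.

Lemma rep_coset x : exists2 z, Z z & x = rep (coset qZ x) + q%:R *: z.
Proof.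
have : coset qZ x (rep (coset qZ x)).
  apply: xgetPex; exists x; rewrite /coset /mkset subrr.
  by exists 0; rewrite ?scaler0 //; apply: coweight_lattice0.
move=> [z Zz e]; exists (- z); first exact: coweight_latticeN.
by rewrite scalerN e opprB addrC subrK.
Qed.

(** Labels describe points modulo [q] times the coroot lattice. Such a class is split into its class
    modulo [q] times the coweight lattice and, once a representative is chosen there, a class of
    coweights modulo coroots; the second component produces the index of connection. *)
Definition coset_pair (p : U * A) : set V * set V :=
  let x := alcove_point p in
  (coset qZ x, coset Q (q%:R^-1 *: (x - rep (coset qZ x)))).

Lemma q_neq0 : q%:R != 0 :> R. Proof. by rewrite pnatr_eq0 -lt0n. Qed.

Lemma coset_pair_inj : {in labels &, injective coset_pair}.
Proof.
move=> p p' hp hp' [e1]; rewrite -e1 => /coset_coroot_lattice.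
rewrite -scalerBr opprB addrA subrK; set mu := _ *: _ => Qmu.
have ex : alcove_point p' = alcove_point p - q%:R *: mu.
  by rewrite /mu scalerA divff ?q_neq0 // scale1r opprB addrC subrK.
have h := alcove_pointP hp; have h' := alcove_pointP hp'.
rewrite ex in h'; rewrite -(subr0 (alcove_point p)) -(scaler0 _ q%:R) in h.
have [ew _ ea] := alcove_unique Phi_root Delta_simple c_highest (ltn0Sn n) q_gt0
  (weyl_val _) (coroot_lattice0 Phi_root) h (weyl_val _) Qmu h'.
case: p p' ew ea {hp hp' h h' ex mu Qmu e1} => [w a] [w' a'] /= /val_inj -> ea.
congr pair; apply/ffunP => i; apply/val_inj.
exact: (congr1 (fun f => f i) ea).
Qed.

Lemma coset_pair_image : coset_pair @` [set p | labels p] =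
  (coset qZ @` linial_complement) `*` (coset Q @` Z).
Proof.
apply/seteqP; split=> [_ [p hp <-]|[_ _] [[x0 [Zx0 hx0] /= <-] [z0 Zz0 <-]]].
  have hx := alcove_point_complement hp; split; first by exists (alcove_point p).
  have [z Zz e] := rep_coset (alcove_point p).
  exists z => //=; congr (coset Q _).
  have -> : alcove_point p - rep (coset qZ (alcove_point p)) = q%:R *: z.
    by rewrite [X in X - _]e addrAC subrr add0r.
  by rewrite scalerA mulVf ?q_neq0 // scale1r.
have [z1 Zz1 e1] := rep_coset x0; set r := rep _ in e1.
have Zr : Z r.
  have -> : r = x0 - q%:R *: z1 by rewrite e1 addrK.
  apply: coweight_latticeD => //; apply: coweight_latticeN => i.
  by rewrite dotZr rpredM ?natr_int.
(* This point meets the same residues as [x0] and has [z0] as its second component; the label of its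
   alcove is the preimage. *)
have Zx : Z (r + q%:R *: z0).
  by apply: coweight_latticeD => // i; rewrite dotZr rpredM ?natr_int.
have [|w [mu [a [Ww Qmu ha]]]] :=
    alcove_exists Phi_root Delta_simple c_highest (ltn0Sn n) q_gt0 Zx.
  move=> b k pb kn [d ed]; have [Pb _] := pb.
  apply: (hx0 (b, k)); first by split=> //=; lia.
  have /intrP [d0 ed0] := dot_root_coweight Phi_root Delta_simple Pb Zz0.
  have /intrP [d1 ed1] := dot_root_coweight Phi_root Delta_simple Pb Zz1.
  exists (d + d1 - d0); rewrite /= e1 dotDr dotZr ed1.
  move: ed; rewrite dotDr dotZr ed0 !(intrD, rmorphN) /= => ed.
  have -> : dot b r = k%:R + d%:~R * q%:R - q%:R * d0%:~R by rewrite -ed; ring.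
  ring.
have wU : w \in U.
  by rewrite in_fset_set ?inE //; apply: weyl_finite Phi_root Delta_simple.
have hs := in_alcove_sum Phi_root Ww ha.
have ale i : (a i < q.+1)%N.
  rewrite ltnS -[X in (_ <= X)%N]hs (bigD1 i) //=.
  by have := ext_coef_gt0 Delta_simple c_highest i; nia.
pose p : U * A := ([` wU]%fset, [ffun i => Ordinal (ale i)]).
have hp : labels p.
  apply/eqP; rewrite -[RHS]hs /=; congr (_ + _)%N.
  by apply: eq_bigr => i _; rewrite ffunE.
have ep : alcove_point p = r + q%:R *: z0 - q%:R *: mu.
  have [v Wv [K K']] := weyl_inv Phi_root Ww.
  rewrite -[RHS]K' /alcove_point /=; congr w.
  apply: (dot_Delta_inj Delta_simple) => j; rewrite dot_coweight.
  rewrite -[RHS](weyl_dot Phi_root Ww) K' -(ext_root_lift _ c j) ha muln0 subr0.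
  by rewrite ffunE.
have e2 : coset qZ (alcove_point p) = coset qZ x0.
  apply/coset_dilate_coweight; exists (z0 - mu - z1).
    apply: coweight_latticeD; last exact: coweight_latticeN.
    by apply: coweight_latticeD => //; apply/coweight_latticeN/coroot_lattice_coweight.
  by rewrite ep e1 !scalerBr -!addrA; congr (_ + _); rewrite [RHS]addrC -!addrA addNr addr0.
exists p => //; rewrite /coset_pair e2; congr pair.
apply/coset_coroot_lattice; rewrite -/r ep.
rewrite addrAC [r + _]addrC addrK -scalerBr scalerA mulVf ?q_neq0 // scale1r.
by rewrite addrAC subrr add0r; apply: coroot_latticeN Phi_root _ _.
Qed.

Lemma card_labels : #|labels| =
  (\sum_(w : U) if (m * asc Phi Delta c (val w) <= q)%N then
     count_sols (ext_coef c) (q - m * asc Phi Delta c (val w)) else 0)%N.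
Proof.
rewrite -sum1_card big_mkcond /=.
rewrite -(pair_bigA _ (fun w a => if (w, a) \in labels then 1 else 0)%N) /=.
apply: eq_bigr => w _; rewrite -big_mkcond sum1_card.
case: leqP => le.
  rewrite -(@card_sols _ _ (ext_coef_gt0 Delta_simple c_highest) q.+1).
    apply: eq_card => a; rewrite !inE /labels /=.
    by rewrite -[in RHS](eqn_add2r (m * asc Phi Delta c (val w))) subnK.
  by rewrite ltnS leq_subr.
apply: eq_card0 => a; rewrite !inE /labels /=; apply/negP => /eqP e; lia.
Qed.

Lemma nonempty_coset_coweight : coset Q @` Z !=set0.
Proof. by exists (coset Q 0), 0 => //; apply: coweight_lattice0. Qed.

Lemma finite_linial_cosets : linial_complement !=set0 ->
  finite_set (coset qZ @` linial_complement) /\ finite_set (coset Q @` Z).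
Proof.
move=> [x hx]; apply: finite_setM_proj nonempty_coset_coweight.
  by rewrite -coset_pair_image; apply/finite_image/finite_finset.
by exists (coset qZ x), x.
Qed.

Lemma index_mul_complement :
  (index_of_connection Phi Delta * complement_count Delta (linial Phi Delta n) q)%N =
  #|labels|.
Proof.
rewrite -(card_fset_set_image coset_pair_inj) coset_pair_image mulnC.
(* A finite product has finite factors only when neither is empty; with an empty complement both
   sides are 0. *)
have [ne|e] := pselect (linial_complement !=set0).
  by have [f1 f2] := finite_linial_cosets ne; rewrite card_fset_setM.
have e0 : linial_complement = set0.
  by apply/seteqP; split=> // x hx; case: e; exists x.
rewrite /complement_count /card_cosets -/linial_complement e0 image_set0 set0X.
by rewrite !fset_set0 !cardfs0 mul0n.
Qed.

End Modulus.

(** For [n = 0] and [q = 1] the complement contains 0, so the label count itself shows that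
    coweights modulo coroots are finite in number. *)
Lemma index_of_connection_gt0 : (0 < index_of_connection Phi Delta)%N.
Proof.
rewrite /index_of_connection /card_cosets.
have [|_ f] := @finite_linial_cosets 0 1 isT.
  exists 0; split; first exact: coweight_lattice0.
  by move=> [b k] [_ /=]; lia.
rewrite cardfs_gt0; apply/fset0Pn; exists (coset Q 0).
by rewrite in_fset_set // inE; exists 0 => //; apply: coweight_lattice0.
Qed.

Lemma complement_count0 q : (0 < q)%N ->
  complement_count Delta (linial Phi Delta 0) q = (q ^ l)%N.
Proof.
move=> q0; have qn0 : q%:R != 0 :> R by rewrite pnatr_eq0 -lt0n.
pose F (v : {ffun 'I_l -> 'I_q}) := coset (dilate q%:R Z) (coweight (fun i => (v i)%:R)).
have inj : {in xpredT &, injective F}.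
  move=> v v' _ _ /coset_dilate_coweight [z Zz e]; apply/ffunP => i; apply/val_inj.
  have /intrP [d ed] := Zz i; have := congr1 (dot (Delta i)) e.
  rewrite dotDr dotZr !dot_coweight ed => /eqP.
  rewrite !pmulrn -intrM -intrD eqr_int => /eqP {}e.
  have [h1 h2] := (ltn_ord (v i), ltn_ord (v' i)); rewrite /=.
  have : d = 0 \/ 1 <= d \/ d <= -1 by lia.
  by case=> [|[]] ?; nia.
rewrite -[in RHS](card_ord q) -[in RHS](card_ord l) -card_ffun.
rewrite -(card_fset_set_image inj) /complement_count /card_cosets.
congr #|` fset_set _|; apply/seteqP; split=> [_ [x [Zx _] <-]|_ [v _ <-]]; last first.
  exists (coweight (fun i => (v i)%:R)) => //; split.
    by move=> i; rewrite dot_coweight natr_int.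
  by move=> [b k] [_ /=]; lia.
have /boolp.choice [d hd] : forall i, exists d : int, dot (Delta i) x = d%:~R.
  by move=> i; apply/intrP.
have lt i : (absz (d i %% q)%Z < q)%N.
  have := @ltz_pmod (d i) q; have := @modz_ge0 (d i) q; lia.
exists [ffun i => Ordinal (lt i)] => //.
apply/coset_dilate_coweight; exists (coweight (fun i => - (d i %/ q)%Z%:~R)).
  by move=> i; rewrite dot_coweight rpredN intr_int.
apply: (dot_Delta_inj Delta_simple) => i; rewrite dotDr dotZr !dot_coweight hd ffunE /=.
have -> : (absz (d i %% q)%Z)%:R = (d i %% q)%Z%:~R :> R.
  by rewrite pmulrn; congr (_%:~R); have := @modz_ge0 (d i) q; lia.
have -> : (d i)%:~R = (d i %/ q)%Z%:~R * q%:R + (d i %% q)%Z%:~R :> R.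
  by rewrite pmulrn -intrM -intrD -divz_eq.
ring.
Qed.

(** The variable of index [ord0], with coefficient 1, is the slack in the inequality for the highest
    root. *)
Lemma ehrhart_countE q : (0 < q)%N ->
  ehrhart_count Delta c q = count_sols (ext_coef c) q.
Proof.
move=> q0; have qn0 : q%:R != 0 :> R by rewrite pnatr_eq0 -lt0n.
pose F (a : {ffun 'I_l.+1 -> 'I_q.+1}) : V := coweight (fun j => (a (lift ord0 j))%:R).
have cg := coef_gt0 Delta_simple c_highest.
rewrite /count_sols -(@card_fset_set_image _ _ _ F); last first.
  move=> a b; rewrite !inE => /eqP ea /eqP eb eF.
  have e j : a (lift ord0 j) = b (lift ord0 j).
    apply/val_inj/eqP; rewrite -(eqr_nat R); apply/eqP.
    by have := congr1 (dot (Delta j)) eF; rewrite !dot_coweight.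
  apply/ffunP => i; case: (unliftP ord0 i) => [j|] -> //.
  apply/val_inj/eqP; move: ea eb; rewrite !big_ord_recl ext_coef0 !mul1n.
  under eq_bigr => j _ do rewrite e.
  by move=> ea eb; have /eqP := etrans ea (esym eb); rewrite eqn_add2r.
rewrite /ehrhart_count; congr #|` fset_set _|; apply/seteqP; split=> x; last first.
  move=> [a /eqP ea <-]; split; last by move=> i; rewrite dot_coweight natr_int.
  exists (q%:R^-1 *: F a); last by rewrite scalerA divff // scale1r.
  split=> [i|]; first by rewrite dotZr dot_coweight mulr_ge0 ?invr_ge0.
  rewrite dotZr mulrC ler_pdivrMr ?ltr0n // mul1r -[X in _ <= X%:R]ea dot_suml.
  rewrite big_ord_recl natrD natr_sum -[X in X <= _]add0r lerD //.
  apply: ler_sum => i _; rewrite dotZl dot_coweight -natrM ext_coef_lift //.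
move=> [[y [y0 y1] <-] Zx].
have /boolp.choice [d hd] : forall i, exists d : nat, dot (Delta i) (q%:R *: y) = d%:R.
  move=> i; apply/natrP; rewrite natrEint Zx dotZr mulr_ge0 //.
have le : (\sum_i c i * d i <= q)%N.
  rewrite -(ler_nat R) natr_sum.
  have -> : \sum_i (c i * d i)%:R = dot (root_of_coefs Delta c) (q%:R *: y).
    by rewrite dot_suml; apply: eq_bigr => i _; rewrite dotZl hd natrM.
  by rewrite dotZr ger_pMr // ltr0n.
pose a i := if unlift ord0 i is Some j then d j else (q - \sum_i c i * d i)%N.
have aj j : a (lift ord0 j) = d j by rewrite /a liftK.
have ea : (\sum_i ext_coef c i * a i)%N = q.
  rewrite big_ord_recl ext_coef0 mul1n {1}/a unlift_none.
  rewrite -[RHS](subnK le); congr (_ + _)%N.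
  by apply: eq_bigr => j _; rewrite ext_coef_lift aj.
have ale i : (a i < q.+1)%N.
  rewrite ltnS -[X in (_ <= X)%N]ea (bigD1 i) //=.
  by have := ext_coef_gt0 Delta_simple c_highest i; nia.
exists [ffun i => Ordinal (ale i)].
  by apply/eqP; rewrite -[RHS]ea; apply: eq_bigr => i _; rewrite ffunE.
apply: (dot_Delta_inj Delta_simple) => j; rewrite dot_coweight hd ffunE /=.
by rewrite aj.
Qed.

(** Otherwise all [w (eps i)] have negative height, against the relation [ext_root_sum]. Hence the
    Eulerian polynomial has no constant term. *)
Lemma asc_gt0 w : W w -> (0 < asc Phi Delta c w)%N.
Proof.
move=> Ww; rewrite lt0n; apply/negP => /eqP e0.
have nin i : w (eps i) \notin pos.
  apply/negP => pi; have := ext_coef_gt0 Delta_simple c_highest i.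
  by move: e0; rewrite /asc (bigD1 i) //=; lia.
have := dot0l (rhov Delta_simple).
have w0 : w 0 = 0 by have := weylZ Phi_root Ww 0 0; rewrite !scale0r.
rewrite -[X in dot X _]w0 -(ext_root_sum Delta c) (weyl_sum Phi_root Ww) dot_suml => /eqP.
rewrite -oppr_eq0 -sumrN psumr_eq0 => [/allP /(_ ord0 (mem_index_enum _))|i _].
  rewrite ext_coef0 scale1r oppr_eq0 => /eqP e; have := ht_notin_pos Phi_root Delta_simple
    (weyl_root Phi_root Ww (ext_root_root Phi_root Delta_simple c_highest ord0)) (nin ord0).
  by rewrite e ltxx.
rewrite oppr_ge0 (weylZ Phi_root Ww) dotZl mulr_ge0_le0 // ltW //.
by apply: ht_notin_pos (nin i) => //; apply: (weyl_root Phi_root Ww); apply: ext_root_root.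
Qed.

Section Generating.
Variable K : numFieldType.
Local Notation gen := (count_gen K (ext_coef c)).

Definition eulerian_poly : {poly K} :=
  (index_of_connection Phi Delta)%:R^-1 *:
  \sum_(w : fset_set W) 'X^(asc Phi Delta c (val w)).

(** The label count divided by the index, as a coefficient of a product. The alcove count needs
    [q > 0]; at [q = 0] the coefficient vanishes because every [asc] is positive. *)
Lemma coef_eulerian_gen m N q : (0 < m)%N -> (q < N)%N ->
  ((eulerian_poly \Po 'X^m) * gen N)`_q =
  if q == 0%N then 0 else (complement_count Delta (linial Phi Delta m.-1) q)%:R.
Proof.
case: m => // n _ ltq.
rewrite /eulerian_poly comp_polyZ -scalerAl coefZ.
rewrite (raddf_sum (comp_poly 'X^(n.+1))) mulr_suml coef_sum.
have term (w : fset_set W) : ((('X^(asc Phi Delta c (val w)) \Po 'X^(n.+1)) * gen N)`_q : K) =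
    (if (n.+1 * asc Phi Delta c (val w) <= q)%N then
      count_sols (ext_coef c) (q - n.+1 * asc Phi Delta c (val w)) else 0%N)%:R.
  rewrite comp_Xn_poly -exprM coefXnM ltnNge; case: leqP => //= le.
  by apply: coef_count_gen; [exact: (ext_coef_gt0 Delta_simple c_highest)|exact: leq_ltn_trans (leq_subr _ _) ltq].
under eq_bigr => w _ do rewrite term.
rewrite -natr_sum; case: eqP => [q0|/eqP].
  rewrite q0 big1 ?mulr0 // => w _; case: leqP => //.
  by have := asc_gt0 (weyl_val w); nia.
rewrite -lt0n => q0; rewrite -(card_labels n q0) -(index_mul_complement n q0) natrM mulKf //.
by rewrite pnatr_eq0 -lt0n index_of_connection_gt0.
Qed.

End Generating.
End Counting.

(** * The characteristic quasi-polynomial *)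

Section Main.
Variables (R : realType) (l : nat).
Local Notation V := 'rV[R]_l.
Local Notation K := (R[i]).
Variables (Phi : set V) (Delta : 'I_l -> V) (c : 'I_l -> nat).
Hypothesis Phi_root : root_system Phi.
Hypothesis Phi_nonempty : Phi !=set0.
Hypothesis Delta_simple : simple_roots Phi Delta.
Hypothesis c_highest : highest_root Phi Delta (root_of_coefs Delta c).
Local Notation L := (ehrhart Delta c).
Local Notation denom := (@partition_denom K l.+1 (ext_coef c)).
Local Notation gen := (count_gen K (ext_coef c)).
Let C_gt0 := ext_coef_gt0 Delta_simple c_highest.

Lemma rank_gt0 : (0 < l)%N.
Proof.
have [a Pa] := Phi_nonempty; rewrite lt0n; apply/eqP => l0.
apply: (root_nz Phi_root Pa); apply/rowP => i.
by have := ltn_ord i; rewrite {2}l0.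
Qed.

(** The content is that a quasi-polynomial with these values exists, so that the choice in [ehrhart]
    is not the default one. *)
Lemma ehrhart_spec : quasi_polynomial L /\
  forall q : nat, (0 < q)%N -> L q = (count_sols (ext_coef c) q)%:R.
Proof.
suff [hq hL] : quasi_polynomial L /\
    forall q : nat, (0 < q)%N -> L q = (ehrhart_count Delta c q)%:R.
  split=> // q q0; rewrite hL // (ehrhart_countE Delta_simple c_highest) //.
apply: (xgetPex (fun=> 0 : K)
  (P := [set g | quasi_polynomial g /\
     forall q : nat, (0 < q)%N -> g q%:Z = (ehrhart_count Delta c q)%:R])).
set M := (\prod_i ext_coef c i)%N.
have M0 : (0 < M)%N by rewrite prodn_gt0.
have [E eE] := @denom_dvd_period K l.+1 (ext_coef c).
(* As [denom] is not constant, [E] has size at most [M * l.+1], so the recurrence already holds from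
   the index that the extension requires. *)
have [q le|g hg hgu] :=
    @period_seq_extend R l.+1 M (fun q => (count_sols (ext_coef c) q)%:R) M0.
  have sX : size (('X^M - 1) ^+ l.+1 : {poly K}) = (M * l.+1).+1.
    rewrite -(prednK (n := size _)) ?size_exp ?size_XnsubC //.
    by rewrite lt0n size_poly_eq0 expf_eq0 -size_poly_eq0 size_XnsubC.
  have sd := size_denom K C_gt0 (ltn0Sn l).
  have nzd : denom != 0 by rewrite -size_poly_eq0 -lt0n (ltn_trans _ sd).
  have nzE : E != 0.
    by apply: contra_eq_neq eE => ->; rewrite mul0r -size_poly_eq0 sX.
  have sE : (size E + size denom).-1 = (M * l.+1).+1.
    by rewrite -size_mul // -eE sX.
  rewrite -/M in eE *; rewrite eE; apply: denom_mul_eq0 => //.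
    have aux e d x y : ((e + d).-1 = x.+1 -> 1 < d -> x <= y -> e <= y)%N by lia.
    exact: aux sE sd le.
  by rewrite -eE sX.
exists g; split; first by exists M.
by move=> q q0; rewrite hgu (ehrhart_countE Delta_simple c_highest).
Qed.

(** The bound keeps every [q - k] positive, where [L] is known to be the count. *)
Lemma shift_poly_ehrhart (P : {poly K}) (q : nat) : (size P <= q)%N ->
  shift_poly P L q = (P * gen q.+1)`_q.
Proof.
move=> le; have [_ hL] := ehrhart_spec.
rewrite coef_mul_apply ?(leq_trans le) //; apply: eq_coef_apply => k ltk.
rewrite coef_count_gen ?ltnS ?leq_subr // -hL ?subn_gt0 ?(leq_trans ltk) //.
by rewrite subzn // ltnW // (leq_trans ltk).
Qed.

Lemma quasi_polynomial0 : quasi_polynomial ((fun=> 0) : int -> K).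
Proof. by exists 1%N; split=> // j; exists 0 => t _; rewrite horner0. Qed.

(** At large [q] this is a coefficient of the constant polynomial 1; quasi-polynomiality carries it
    to all integers. *)
Lemma shift_denom_ehrhart t : shift_poly denom L t = 0.
Proof.
have [qL _] := ehrhart_spec.
suff -> : shift_poly denom L = fun=> 0 by [].
apply: (@quasi_eq_large _ _ _ (size denom)) quasi_polynomial0 _ => [|q lt].
  by exists (min_period L); apply/is_period_shift/min_periodP.
have e := coef_mul_denom_count_gen C_gt0 (1 : {poly K}) (ltnSn q).
rewrite mul1r coef1 in e.
by rewrite (shift_poly_ehrhart (ltnW lt)) e; case: q lt {e}.
Qed.

Lemma eulerianE : eulerian Phi Delta c = eulerian_poly Phi Delta c K.
Proof.
rewrite /eulerian /eulerian_poly fsbig_finite; last exact: weyl_finite Delta_simple.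
by rewrite big_seq_fsetE.
Qed.

Lemma eulerian_dvd :
  exists T, ('X - 1) ^+ l.+1 * eulerian Phi Delta c = T * denom.
Proof.
apply: (worpitzky_dvd C_gt0) => N q lt.
rewrite eulerianE -(comp_polyXr (eulerian_poly _ _ _ _)) -['X]expr1.
rewrite coef_eulerian_gen //=; case: eqP => [->|/eqP].
  (* The zero coefficient must equal [0 ^ l], which holds because a nonempty root system has
     positive rank. *)
  by rewrite expr0n eqn0Ngt rank_gt0.
by rewrite -lt0n => q0; rewrite complement_count0 // natrX.
Qed.

Lemma shift_eulerian_eq0 m t :
  shift_poly (('X^m - 1) ^+ l.+1 * (eulerian Phi Delta c \Po 'X^m)) L t = 0.
Proof.
have [T eT] := eulerian_dvd; have [E eE] := @denom_dvd_comp_Xn K l.+1 (ext_coef c) m.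
have -> : ('X^m - 1) ^+ l.+1 * (eulerian Phi Delta c \Po 'X^m) =
    (T \Po 'X^m) * E * denom.
  rewrite -mulrA -eE -comp_polyM -eT comp_polyM; congr (_ * _).
  by rewrite rmorphXn rmorphB /= comp_polyX rmorph1.
rewrite shift_poly_mul (funext shift_denom_ehrhart); exact: coef_apply_const0.
Qed.

(** The right-hand side is a quasi-polynomial with the required counts at large [q], so it also
    witnesses that the choice in [chi_quasi] is not the default. *)
Lemma chi_quasi_linial n :
  chi_quasi Delta (linial Phi Delta n) =
  shift_poly (eulerian Phi Delta c \Po 'X^(n.+1)) L.
Proof.
have [qL _] := ehrhart_spec.
set H := shift_poly _ _.
have qH : quasi_polynomial H.
  by exists (min_period L); apply/is_period_shift/min_periodP.
have hH q : (size (eulerian Phi Delta c \Po 'X^(n.+1)) < q)%N ->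
    H q = (complement_count Delta (linial Phi Delta n) q)%:R.
  move=> lt; rewrite /H (shift_poly_ehrhart (ltnW lt)) eulerianE.
  by rewrite (coef_eulerian_gen _ _ _ _ (ltn0Sn n) (ltnSn q)); case: q lt.
have [qchi [q0 hchi]] : [set g : int -> K | quasi_polynomial g /\
    exists q0 : nat, forall q : nat, (q0 < q)%N ->
      g q%:Z = (complement_count Delta (linial Phi Delta n) q)%:R]
    (chi_quasi Delta (linial Phi Delta n)).
  by apply: xgetPex; exists H; split=> //; eexists; exact: hH.
apply: (quasi_eq_large (q0 := maxn q0 (size (eulerian Phi Delta c \Po 'X^(n.+1))))) qchi qH _.
by move=> q; rewrite gtn_max => /andP [h1 h2]; rewrite hchi // hH.
Qed.

End Main.

Theorem theorem3p1 (R : realType) (l : nat) (Phi : set 'rV[R]_l)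
    (Delta : 'I_l -> 'rV[R]_l) (c : 'I_l -> nat) (n : nat)
    (Phi_irr : irreducible_root_system Phi)
    (Delta_simple : simple_roots Phi Delta)
    (c_highest : highest_root Phi Delta (root_of_coefs Delta c)) :
  let L := ehrhart Delta c in
  let rho := min_period L in
  let chi := chi_quasi Delta (linial Phi Delta n) in
  (forall t : int,
     chi t = Sbar_poly (eulerian Phi Delta c \Po 'X^(n.+1))
               (average (gcdn n.+1 rho)%:Z L) t) /\
  is_period chi (gcdn n.+1 rho).
Proof.
move=> L rho chi; have [Phi_root Phi_ne _] := Phi_irr.
have [qL _] := ehrhart_spec Delta_simple c_highest.
have [h1 h2] := shift_poly_average qL (ltn0Sn n) erefl
  (shift_eulerian_eq0 Phi_root Phi_ne Delta_simple c_highest n.+1).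
by rewrite /chi (chi_quasi_linial Phi_root Delta_simple c_highest).
Qed.
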